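(* Assume that the deformation model described in the context holds, with $\Lambda\subset\mathbb{R}$, and that: (1) For all $\lambda\in\Lambda$, $\varphi_\lambda:(c,d)\to(a,b)$ is invertible and increasing, where $-\infty\le a<b\le+\infty$ and $-\infty\le c\le c_j<d_j\le d\le+\infty$ for all $j$. (2) $G$ is $C^2$ with $G'(x)=g(x)>0$ on $(a,b)$ and $\sup_{a<x<b}\frac{G(x)(1-G(x))g'(x)}{g(x)^2}<\infty$. (3) $\varphi$ is continuous with respect to $x$ and $\lambda$; for all $\lambda\in\Lambda$, $\varphi_\lambda$ is $C^1$ with respect to $x$; $\Lambda$ is compact. (4) For all $j$, $d\varphi$ is bounded on $\Lambda\times[c_j,d_j]$ and continuous with respect to $\lambda$, and $\sup_{\lambda\in\Lambda}|d\varphi_\lambda(x_n^\lambda)-d\varphi_\lambda(x)|\to0$ whenever $\sup_{\lambda\in\Lambda}|x_n^\lambda-x|\to0$. (5) For all $1\le j\le J$, $\mathbb{E}[|X_j|^r]<\infty$ for some $r>4$. (6) For all $1\le j\le J$, $\mathbb{E}\left[\sup_{\lambda\in\Lambda}|\varphi_\lambda(X_j)|^r\right]<\infty$ for some $r>4$. (7) $U$ has a unique minimizer on $\Theta$, namely $\theta^\star$, and it belongs to the interior of $\Theta$. Let $\widehat\theta^n\in\arg\min_{\theta\in\Theta}U_n(\theta)$. Then $\widehat\theta^n\to\theta^\star$ in probability as $n\to\infty$.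
   Context: Let $J$ be a fixed positive integer, $\Lambda$ a parameter set, $\Theta=\Lambda^J$, and $\varphi:\Lambda\times(c,d)\to(a,b)$, $(\lambda,x)\mapsto\varphi_\lambda(x)$, a family of deformation functions. $d$ denotes the derivative with respect to $x$ (so $d\varphi_\lambda=\varphi_\lambda'$). Deformation model: there are $\theta^\star=(\theta_1^\star,\dots,\theta_J^\star)\in\Theta$ and i.i.d. real random variables $\varepsilon_{i,j}$ ($i\ge1$, $1\le j\le J$) with law $\mu$, supported on $(a,b)$, with distribution function $G$, such that the observations are $X_{i,j}=\varphi_{\theta_j^\star}^{-1}(\varepsilon_{i,j})$, $1\le i\le n$, $1\le j\le J$. $X_j$ denotes a generic variable with the law $\mu_j$ of $X_{i,j}$; its distribution function, on $(c_j,d_j)$, is $F_j=G\circ\varphi_{\theta_j^\star}$. $W_2$ is the 2-Wasserstein distance. For $\theta\in\Theta$, $\mu_j(\theta_j)$ is the law of $\varphi_{\theta_j}(X_j)$, $\mu_B(\theta)$ is the Wasserstein barycenter of $\mu_1(\theta_1),\dots,\mu_J(\theta_J)$, i.e. the probability on $\mathbb{R}$ whose quantile function is $\frac1J\sum_{k=1}^J\varphi_{\theta_k}\circ F_k^{-1}$, and $U(\theta)=\frac1J\sum_{j=1}^JW_2^2(\mu_j(\theta_j),\mu_B(\theta))$. Likewise $\mu_{n,j}(\theta_j)$ is the empirical measure of $\varphi_{\theta_j}(X_{1,j}),\dots,\varphi_{\theta_j}(X_{n,j})$, $\mu_{n,B}(\theta)$ is the barycenter of the $\mu_{n,j}(\theta_j)$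 (quantile function equal to the average of their quantile functions), and $U_n(\theta)=\frac1J\sum_{j=1}^JW_2^2(\mu_{n,j}(\theta_j),\mu_{n,B}(\theta))$. *)

(* Defs.v *)
From mathcomp Require Import all_boot all_order all_algebra.
From mathcomp Require Import all_classical all_reals all_analysis.

Set Implicit Arguments.
Unset Strict Implicit.
Unset Printing Implicit Defensive.

Import Order.TTheory GRing.Theory Num.Theory.
Import numFieldNormedType.Exports.

Local Open Scope ring_scope.
Local Open Scope classical_set_scope.

(* Open and closed intervals of reals with endpoints in [-oo, +oo]. *)
Definition ooI (R : realType) (a b : \bar R) : set R :=
  [set x | (a < x%:E < b)%E].

Definition ccI (R : realType) (a b : \bar R) : set R :=
  [set x | (a <= x%:E <= b)%E].

Definition mutually_independent d (T : measurableType d) (R : realType)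
    (P : probability T R) (I : choiceType) (Y : I -> {RV P >-> R}) : Prop :=
  forall (s : seq I) (A : I -> set R), uniq s ->
    (forall i, measurable (A i)) ->
    P (\bigcap_(i in [set` s]) (Y i @^-1` A i)) =
    (\big[*%E/1%E]_(i <- s) P (Y i @^-1` A i))%E.

Definition cvg_in_probability d (T : measurableType d) (R : realType)
    (P : probability T R) (V : normedModType R) (Y : nat -> T -> V) (y : V)
    : Prop :=
  forall e : R, 0 < e ->
    P [set w | e <= `|Y n w - y|] @[n --> \oo] --> (0 : \bar R)%E.

(* Laws on the real line are handled as set functions, so that the image of a
   law under a map known only on an interval needs no proof of measurability. *)

Definition distribution_function (R : realType) (m : set R -> \bar R) (x : R)
    : R :=
  fine (m `]-oo, x]).

Definition quantile (R : realType) (m : set R -> \bar R) (u : R) : R :=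
  inf [set x | u <= distribution_function m x].

(* The probability on R whose quantile function is Q on ]0, 1[ (it is unique
   when it exists; a Dirac mass is returned otherwise). *)
Definition law_with_quantile (R : realType) (Q : R -> R)
    : probability (measurableTypeR R) R :=
  xget (dirac (0 : measurableTypeR R) : probability (measurableTypeR R) R)
    [set nu : probability (measurableTypeR R) R |
      forall u : R, 0 < u < 1 -> quantile nu u = Q u].

(* Law of f Y, for Y of law m concentrated on I: f is evaluated on I only. *)
Definition image_law (R : realType) (m : set R -> \bar R) (I : set R)
    (f : R -> R) : set R -> \bar R :=
  fun A => m (I `&` f @^-1` A).

Definition empirical_law (R : realType) (n : nat) (y : 'I_n -> R)
    : set R -> \bar R :=
  fun A => ((n%:R^-1 : R)%:E * \sum_(i < n) \d_(y i) A)%E.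

Definition coupling (R : realType) (m1 m2 : set R -> \bar R)
    : set (probability (measurableTypeR R * measurableTypeR R)%type R) :=
  [set pi | forall A : set R, measurable A ->
    pi (A `*` setT) = m1 A /\ pi (setT `*` A) = m2 A].

Definition W2 (R : realType) (m1 m2 : set R -> \bar R) : \bar R :=
  sqrte (ereal_inf
    [set (\int[pi]_z ((z.1 - z.2) ^+ 2)%:E)%E | pi in coupling m1 m2]).

Definition mean_sqr_W2 (R : realType) (J : nat) (m : 'I_J -> set R -> \bar R)
    (mB : set R -> \bar R) : \bar R :=
  ((J%:R^-1 : R)%:E * \sum_(j < J) W2 (m j) mB ^+ 2)%E.

(* The powers Lambda ^ J, as row vectors. *)
Definition parameter_space (R : realType) (J : nat) (Lambda : set R)
    : set 'rV[R]_J :=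
  [set theta | forall j, Lambda (theta ord0 j)].

(* The criterion U: m j is the law mu_j of X_j, concentrated on I. *)
Definition criterion (R : realType) (J : nat) (phi : R -> R -> R) (I : set R)
    (m : 'I_J -> set R -> \bar R) (theta : 'rV[R]_J) : \bar R :=
  mean_sqr_W2 (fun j => image_law (m j) I (phi (theta ord0 j)))
    (law_with_quantile (fun u =>
      J%:R^-1 * \sum_(k < J) phi (theta ord0 k) (quantile (m k) u))).

(* The criterion U_n for the observations x i j, i < n. *)
Definition empirical_criterion (R : realType) (J : nat) (phi : R -> R -> R)
    (n : nat) (x : nat -> 'I_J -> R) (theta : 'rV[R]_J) : \bar R :=
  let m j := empirical_law (fun i : 'I_n => phi (theta ord0 j) (x i j)) in
  mean_sqr_W2 m
    (law_with_quantile (fun u => J%:R^-1 * \sum_(k < J) quantile (m k) u)).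

Definition argmin (T : Type) (R : realType) (D : set T) (f : T -> \bar R)
    : set T :=
  [set x | D x /\ forall y, D y -> (f x <= f y)%E].

(* Main.v *)
(* The criterion [U] vanishes as soon as the laws of [phi theta_j (X j)] all
   coincide, so it is enough to show that, with probability tending to one,
   [Un thetas] is arbitrarily small while [Un] is bounded away from [0] outside
   a neighbourhood of [thetas]; the general theory of barycenters and the
   optimality of the quantile coupling are not involved.

   If [theta] in [Lambda ^ J] differs from [thetas], then [U theta <> 0], and
   some quantiles satisfy [phi theta_j z1 < phi theta_k z2] with
   [F_k z2 < F_j z1]. Since the [phi l] are increasing, this is an inequality
   between the frequencies of [eps_ij <= phi thetas_j z1] and
   [eps_ik <= phi thetas_k z2], which the law of large numbers makes robust,
   uniformly for [theta'] near [theta]; and for any law [nu], Chebyshev's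
   inequality in a coupling bounds the difference of the distribution functions
   of [m_j] and [m_k] at two distinct points by [W2 m_j nu ^+ 2 + W2 m_k nu ^+ 2].
   Compactness of [Lambda ^ J] yields a uniform lower bound.

   At [thetas] the transformed data are the [eps_ij]. The quantile coupling
   bounds [Un thetas] by integrals of squared differences of empirical quantile
   functions, hence by fourth moments (for the tails) and by differences of
   empirical distribution functions on a finite grid. *)

Require Import Defs.
From mathcomp Require Import all_boot all_order all_algebra.
From mathcomp Require Import all_classical all_reals all_analysis.
From mathcomp Require Import measurable_realfun ring lra.

Set Implicit Arguments.
Unset Strict Implicit.
Unset Printing Implicit Defensive.

Import Order.TTheory GRing.Theory Num.Theory.
Import numFieldNormedType.Exports.

Local Open Scope ring_scope.
Local Open Scope classical_set_scope.

(** * Quantile functions and the uniform law *)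

(** The existential form gives an equality of set functions to rewrite with, the measurability proof
    staying out of the terms. *)
Lemma pushforward_probability d d' (T : measurableType d)
    (T' : measurableType d') (R : realType) (P : probability T R) (f : T -> T') :
  measurable_fun setT f ->
  exists q : probability T' R, q = pushforward P f :> (set T' -> \bar R).
Proof.
by move=> mf; exists (distribution P (mfun_Sub (mem_set mf))).
Qed.

Section quantile_functions.
Context {R : realType}.
Implicit Types (p : probability (measurableTypeR R) R) (Q F : R -> R).

Definition unit_uniform : probability (measurableTypeR R) R :=
  uniform_prob (@ltr01 R).

Lemma unit_uniform_ray (v : R) : 0 <= v <= 1 ->
  unit_uniform `]-oo, v] = v%:E.
Proof.
move=> /andP[v0 v1]; rewrite /unit_uniform /= /uniform_prob.
rewrite integral_uniform_pdf.
have -> : `]-oo, v] `&` `[0, 1] = `[0, v] :> set R.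
  apply/seteqP; split=> x /=; rewrite !in_itv/=; first by move=> [-> /andP[->]].
  by move=> /andP[-> xv]; split=> //; exact: le_trans xv v1.
rewrite (eq_integral (fun=> 1%E)); last first.
  move=> x; rewrite inE/= in_itv/= /uniform_pdf => /andP[x0 xv].
  by rewrite x0 (le_trans xv v1) subr0 invr1.
rewrite integral_cst//= mul1e lebesgue_measure_itv/= lte_fin.
case: ltP => [_|v0']; first by rewrite oppr0 addr0.
by rewrite (@le_anti _ _ v 0) // v0 v0'.
Qed.

(** Outside ]0, 1[ a quantile is the infimum of a set that may be empty or unbounded below; the
    value 0 is put there, on a null set for [unit_uniform]. *)
Definition on_unit Q (u : R) : R := if 0 < u < 1 then Q u else 0.

(* A Galois connection on ]0, 1[: the relation between a distribution function
   [F] and its quantile function [Q], whose values outside ]0, 1[ are junk. *)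
Definition galois_pair Q F := forall x, 0 <= F x <= 1 /\
  forall u, 0 < u < 1 -> (Q u <= x) = (u <= F x).

(** By the Galois connection the preimage of a ray is the trace of a ray on ]0,
    1[, together with the complement of ]0, 1[ when the ray contains the default value 0. *)
Lemma on_unit_measurable Q F : galois_pair Q F ->
  @measurable_fun _ _ (measurableTypeR R) (measurableTypeR R) setT (on_unit Q).
Proof.
move=> QF; apply: (measurability _ (RGenOInfty.measurableE R)).
move=> /= _ [_ [x ->] <-]; rewrite setTI.
have [Fx01 QFx] := QF x.
have -> : on_unit Q @^-1` `]x, +oo[ =
    (`]0, 1[ `&` ~` `]-oo, F x]) `|`
    (if 0 <= x then set0 else ~` `]0, 1[ : set R).
  apply/seteqP; split=> u /=; rewrite !in_itv/= andbT /on_unit.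
    case: ifPn => [u01|u01]; first by rewrite ltNge QFx// => /negP; left.
    by rewrite ltNge => /negbTE ->; right; rewrite /= in_itv/=; exact/negP.
  case=> [[u01 /negP]|]; first by rewrite u01 -QFx// -ltNge.
  by case: ifPn => //= ; rewrite -ltNge in_itv/= => x0 /negP/negbTE ->.
apply: measurableU; first by apply: measurableI => //; exact: measurableC.
by case: ifP => _; [exact: measurable0|exact: measurableC].
Qed.

Lemma unit_uniform_itvoo : unit_uniform `]0, 1[ = 1%E.
Proof.
rewrite /unit_uniform /= /uniform_prob integral_uniform_pdf.
rewrite setIidl; last exact: subset_itvW.
rewrite (eq_integral (fun=> 1%E)); last first.
  move=> x; rewrite inE/= in_itv/= /uniform_pdf => /andP[x0 x1].
  by rewrite (ltW x0) (ltW x1) subr0 invr1.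
by rewrite integral_cst//= mul1e lebesgue_measure_itv/= lte01 oppr0 adde0.
Qed.

Lemma measureI_full d (T : measurableType d) (P : probability T R)
    (A B : set T) :
  measurable A -> measurable B -> P A = 1%E -> P (A `&` B) = P B.
Proof.
move=> mA mB PA.
have PnA : P (~` A) = 0%E by rewrite probability_setC// PA subee.
have mnA : measurable (~` A) by exact: measurableC.
have mBA : measurable (B `&` A) by exact: measurableI.
have mBnA : measurable (B `&` ~` A) by exact: measurableI.
rewrite -[in RHS](setIT B) -(setUv A) setIUr measureU//; last first.
  by rewrite setIACA setICr setI0.
rewrite (@subset_measure0 _ _ _ P (B `&` ~` A) (~` A))//.
by rewrite adde0 setIC.
Qed.

(** Inverse transform sampling: on ]0, 1[, which has full measure, [Q u <= x] is the event
    [u <= F x]. *)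
Lemma unit_uniform_on_unit Q F (QF : galois_pair Q F) x :
  unit_uniform (on_unit Q @^-1` `]-oo, x]) = (F x)%:E.
Proof.
have [Fx01 QFx] := QF x.
rewrite -(measureI_full _ _ unit_uniform_itvoo)//; last first.
  rewrite -[X in measurable X]setTI.
  exact: (on_unit_measurable QF).
rewrite -unit_uniform_ray// -[RHS](measureI_full _ _ unit_uniform_itvoo)//.
congr (_ _); apply/seteqP; split=> u /=; rewrite !in_itv/= /on_unit.
  by move=> [u01]; rewrite u01 QFx.
by move=> [u01]; rewrite u01 QFx.
Qed.

Lemma galois_pair_inf Q F u : galois_pair Q F -> 0 < u < 1 ->
  inf [set x | u <= F x] = Q u.
Proof.
move=> QF u01; rewrite (_ : [set x | _] = `[Q u, +oo[); first exact: inf_itv.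
apply/seteqP; split=> x /=; rewrite in_itv/= andbT; have [_ ->//] := QF x.
Qed.

Lemma measurable_rays :
  @measurable _ (measurableTypeR R) = <<s [set `]-oo, x] | x in [set: R]] >>.
Proof.
rewrite eqEsubset; split => A.
  apply: smallest_sub; first exact: smallest_sigma_algebra.
  move=> _ [[a b] _ <-] /=.
  rewrite (_ : `]a, b] = `]-oo, b] `\` `]-oo, a]); last first.
    apply/seteqP; split=> x /=; rewrite !in_itv/=.
      by move=> /andP[ax xb]; split=> //; apply/negP; rewrite -ltNge.
    by move=> [-> /negP]; rewrite -ltNge => ->.
  apply: (@measurableD _ (g_sigma_algebraType [set `]-oo, x] | x in [set: R]]));
    by apply: sub_sigma_algebra; eexists.
by apply: smallest_sub; [exact: smallest_sigma_algebra|move=> _ [x _ <-] /=].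
Qed.

(** Uniqueness on a pi-system: the rays are stable under intersection, generate the Borel sets and
    exhaust the line. *)
Lemma eq_probability_rays p1 p2 :
  (forall x, p1 `]-oo, x] = p2 `]-oo, x]) ->
  forall A, measurable A -> p1 A = p2 A.
Proof.
move=> e A mA; pose G := [set (`]-oo, x] : set (measurableTypeR R)) | x in [set: R]].
apply: (@measure_unique _ R (measurableTypeR R) G (fun n => `]-oo, n%:R]%classic)
  measurable_rays) => //.
- move=> _ _ [x _ <-] [y _ <-]; exists (Num.min x y) => //.
  by apply/seteqP; split=> z /=; rewrite !in_itv/= le_min => /andP.
- by move=> n; eexists.
- rewrite -subTset => x _; exists (Num.truncn x).+1 => //=.
  by rewrite in_itv/= ltW// truncnS_gt.
- by move=> _ [x _ <-]; exact: e.
- by move=> k; rewrite (le_lt_trans (probability_le1 _ _)) ?ltry.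
Qed.

Lemma law_of_galois_pair Q F : galois_pair Q F ->
  exists p, forall x, p `]-oo, x] = (F x)%:E.
Proof.
move=> QF; have mQ := on_unit_measurable QF.
have [p pE] := pushforward_probability unit_uniform mQ.
by exists p => x; rewrite pE; exact: unit_uniform_on_unit.
Qed.

Lemma distribution_functionE p x : (distribution_function p x)%:E = p `]-oo, x].
Proof. by rewrite fineK// fin_num_measure. Qed.

Lemma distribution_function_itv01 p x : 0 <= distribution_function p x <= 1.
Proof.
by rewrite -!lee_fin distribution_functionE measure_ge0 probability_le1.
Qed.

Lemma distribution_function_homo p :
  {homo distribution_function p : x y / x <= y}.
Proof.
move=> x y xy; rewrite -lee_fin !distribution_functionE le_measure ?inE//.
exact: subitvPr.
Qed.

(** The infimum defining the quantile is attained because a distribution function is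
    right-continuous; its limits at -oo and +oo make the set bounded below and nonempty when
    [0 < u < 1]. *)
Lemma quantile_galois_pair p : galois_pair (quantile p) (distribution_function p).
Proof.
move=> x; split=> [|u /andP[u0 u1]]; first exact: distribution_function_itv01.
pose X : {RV p >-> R} := @mfun_Sub _ _ (measurableTypeR R) R idfun
  (mem_set (@measurable_id _ (measurableTypeR R) setT)).
have XE y : cdf X y = (distribution_function p y)%:E by rewrite distribution_functionE.
have lbS : exists y, lbound [set x | u <= distribution_function p x] y.
  have [y yu] : exists y, distribution_function p y < u.
    have /fine_cvg := @cvg_cdfNy0 _ _ _ _ X.
    move=> /cvgr_lt/(_ _ u0) [M [_ hM]]; exists (M - 1).
    by have := hM (M - 1); rewrite /= XE /=; apply; rewrite ltrBlDr ltrDl.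
  exists y => z /= uz; rewrite leNgt; apply/negP => zy.
  have := distribution_function_homo p (ltW zy).
  by move=> /(le_trans uz)/(lt_le_trans yu); rewrite ltxx.
have neS : [set x | u <= distribution_function p x] !=set0.
  have /fine_cvg := @cvg_cdfy1 _ _ _ _ X.
  move=> /cvgr_gt/(_ _ u1) [M [_ hM]]; exists (M + 1) => /=.
  by have := hM (M + 1); rewrite /= XE /= => hM1; apply/ltW/hM1; rewrite ltrDl.
apply/idP/idP => [qx|ux]; last exact: ge_inf.
apply: le_trans (distribution_function_homo p qx).
have : (fine \o cdf X) y @[y --> (quantile p u)^'+] -->
    distribution_function p (quantile p u).
  by apply: fine_cvg; rewrite -XE; exact: cdf_right_continuous.
move=> /cvgr_to_ge; apply; near=> y; rewrite /= XE/=.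
have qy : quantile p u < y by near: y; exact: nbhs_right_gt.
have [z /= uz zy] := inf_lt neS qy.
by apply: le_trans uz _; exact/distribution_function_homo/ltW.
Unshelve. all: by end_near. Qed.

End quantile_functions.

(** * The quantile coupling and bounds on the Wasserstein distance *)

Lemma integral_cst_probability d (T : measurableType d) (R : realType)
    (P : probability T R) (r : R) : (\int[P]_x r%:E = r%:E)%E.
Proof.
by rewrite integral_cst// -[RHS]mule1; congr (_ * _)%E; exact: probability_setT.
Qed.

(** Markov's inequality. *)
Lemma lower_bound_le_integral d (T : measurableType d) (R : realType)
    (P : {measure set T -> \bar R}) (f : T -> R) (A : set T) (c : R) :
  measurable_fun setT f -> (forall x, 0 <= f x) -> measurable A -> 0 <= c ->
  (forall x, A x -> c <= f x) ->
  (c%:E * P A <= \int[P]_x (f x)%:E)%E.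
Proof.
move=> mf f0 mA c0 cf; rewrite -integral_cst//.
have mfE D : measurable_fun D (EFin \o f).
  by apply/measurable_EFinP; exact: measurable_funTS.
apply: (@le_trans _ _ (\int[P]_(x in A) (f x)%:E)%E).
  by apply: ge0_le_integral => // x Ax; rewrite lee_fin cf.
by apply: ge0_subset_integral => // x _; rewrite lee_fin.
Qed.

Section quantile_coupling.
Context {R : realType}.
Implicit Types (p : probability (measurableTypeR R) R) (Q F : R -> R).

(** The image of the uniform law under [Q] has the required quantiles, so the [xget] in
    [law_with_quantile] does not fall back on its default. *)
Lemma galois_pair_law_with_quantile Q F u : galois_pair Q F -> 0 < u < 1 ->
  quantile (law_with_quantile Q) u = Q u.
Proof.
move=> QF; rewrite /law_with_quantile; move: u.
have [p pE] := law_of_galois_pair QF.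
case: xgetP => [nu _ //|/(_ p) []] u u01; rewrite -(galois_pair_inf QF u01) /quantile.
by congr inf; apply/seteqP; split=> x /=; rewrite /distribution_function pE.
Qed.

Lemma galois_pair_nondecreasing Q F u v : galois_pair Q F ->
  0 < u -> u <= v -> v < 1 -> Q u <= Q v.
Proof.
move=> QF u0 uv v1.
have [_ QFv] := QF (Q v).
have v0 := lt_le_trans u0 uv; have u1 := le_lt_trans uv v1.
by rewrite QFv ?u0//; apply: (le_trans uv); rewrite -QFv ?v0.
Qed.

(** The level [F (Q u - e)] is strictly below [u], and above that level [Q] exceeds [Q u - e]. *)
Lemma galois_pair_left_continuous Q F u : galois_pair Q F -> 0 < u < 1 ->
  Q x @[x --> u^'-] --> Q u.
Proof.
move=> QF /andP[u0 u1]; apply/cvgrPdist_le => e e0.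
have [/andP[F0 F1] QFx] := QF (Q u - e).
have Fu : F (Q u - e) < u by rewrite ltNge -QFx ?u0// -ltNge ltrBlDr ltrDl.
near=> x.
have xu : x < u by near: x; exact: nbhs_left_lt.
have Fx : F (Q u - e) < x by near: x; exact: nbhs_left_gt.
have x0 : 0 < x by exact: le_lt_trans Fx.
have x1 : x < 1 by exact: lt_trans u1.
rewrite ger0_norm ?subr_ge0 ?(galois_pair_nondecreasing QF x0 (ltW xu))//.
by rewrite lerBlDl -lerBlDr ltW// ltNge QFx ?x0// -ltNge.
Unshelve. all: by end_near. Qed.

(** Converse of the two preceding facts: monotonicity and left continuity characterize quantile
    functions, and both are easy to check on an average. *)
Lemma left_continuous_galois_pair Q :
  (forall u v, 0 < u -> u <= v -> v < 1 -> Q u <= Q v) ->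
  (forall u, 0 < u < 1 -> Q x @[x --> u^'-] --> Q u) ->
  exists F, galois_pair Q F.
Proof.
(* Adjoining 0 keeps the set nonempty when no level satisfies [Q u <= x], so that the supremum is
   meaningful and lies in [0, 1]. *)
move=> ndQ lcQ; exists (fun x => sup ([set 0] `|` [set u | 0 < u < 1 /\ Q u <= x])).
move=> x; set S := _ `|` _.
have S0 : S 0 by left.
have ubS : ubound S 1 by move=> v [->|[/andP[_ /ltW]]].
have hS : has_sup S by split; [exists 0|exists 1].
split=> [|u /andP[u0 u1]].
  by apply/andP; split; [apply: ub_le_sup; first exists 1|apply: ge_sup; first exists 0].
apply/idP/idP => [Qx|us].
  by apply: ub_le_sup; [exists 1|right; split=> //; rewrite u0 u1].
have u01 : 0 < u < 1 by rewrite u0.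
apply: (cvgr_to_le (lcQ u u01)); near=> v.
have vu : v < u by near: v; exact: nbhs_left_lt.
have v0 : 0 < v by near: v; exact: nbhs_left_gt.
have [w [->|[/andP[w0 w1] Qw]] vw] := sup_gt (ex_intro _ 0 S0) (lt_le_trans vu us).
  by have := lt_trans v0 vw; rewrite ltxx.
by apply: le_trans Qw; apply: ndQ => //; exact: ltW.
Unshelve. all: by end_near. Qed.

(** This is what makes the barycenter exist: an average of quantile functions is again a quantile
    function. *)
Lemma sum_galois_pair (J : nat) (c : R) (Q F : 'I_J -> R -> R) :
  0 <= c -> (forall j, galois_pair (Q j) (F j)) ->
  exists F', galois_pair (fun u => c * \sum_(j < J) Q j u) F'.
Proof.
move=> c0 QF; apply: left_continuous_galois_pair => [u v u0 uv v1|u u01].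
  apply: ler_wpM2l => //; apply: ler_sum => j _.
  exact: (galois_pair_nondecreasing (QF j)).
apply: cvgM; first exact: cvg_cst.
apply: cvg_big => [|j _]; first exact: add_continuous.
exact: galois_pair_left_continuous (QF j) u01.
Qed.

Lemma on_unit_quantile p (A : set R) : measurable A ->
  unit_uniform (on_unit (quantile p) @^-1` A) = p A.
Proof.
have pQ := quantile_galois_pair p.
have [q qE] := pushforward_probability unit_uniform (on_unit_measurable pQ).
move=> mA; transitivity (q A); first by rewrite qE.
apply: eq_probability_rays => // x.
by rewrite qE -distribution_functionE -(unit_uniform_on_unit pQ).
Qed.

(** Under the uniform law the pair of quantile functions is one particular coupling, whose cost
    bounds the infimum from above. *)
Lemma W2_le_quantile (m1 m2 : set R -> \bar R) p1 p2 :
  (forall A, measurable A -> m1 A = p1 A) ->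
  (forall A, measurable A -> m2 A = p2 A) ->
  (W2 m1 m2 ^+ 2 <= \int[unit_uniform]_u
    ((on_unit (quantile p1) u - on_unit (quantile p2) u) ^+ 2)%:E)%E.
Proof.
move=> m1E m2E; rewrite /W2 sqr_sqrte; last first.
  apply: le_ereal_inf_tmp => _ [pi _ <-]; apply: integral_ge0 => x _.
  by rewrite lee_fin sqr_ge0.
have mQ1 := on_unit_measurable (quantile_galois_pair p1).
have mQ2 := on_unit_measurable (quantile_galois_pair p2).
have [pi piE] := pushforward_probability unit_uniform (measurable_fun_pair mQ1 mQ2).
apply: ereal_inf_lbound; exists pi; last first.
  rewrite piE ge0_integral_pushforward//.
  - exact: measurable_fun_pair.
  - apply/measurable_EFinP; apply: measurable_funX; exact: measurable_funB.
  - by move=> z _; rewrite lee_fin sqr_ge0.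
move=> A mA; rewrite (m1E _ mA) (m2E _ mA) piE /pushforward.
rewrite -(on_unit_quantile p1 mA) -(on_unit_quantile p2 mA).
by split; congr (unit_uniform _); apply/seteqP; split=> u /=; try by case.
Qed.

(** In any coupling, a point with first coordinate at most [s] has its second coordinate either at
    most [t] or more than [t - s] away; Chebyshev's inequality bounds the mass of the second case by
    the cost. *)
Lemma W2_ge_rays (m1 m2 : set R -> \bar R) (s t : R) : s < t ->
  m2 `]-oo, t] \is a fin_num ->
  (((t - s) ^+ 2)%:E * m1 `]-oo, s] <=
   ((t - s) ^+ 2)%:E * m2 `]-oo, t] + W2 m1 m2 ^+ 2)%E.
Proof.
move=> st m2fin; rewrite /W2 sqr_sqrte; last first.
  apply: le_ereal_inf_tmp => _ [pi _ <-]; apply: integral_ge0 => x _.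
  by rewrite lee_fin sqr_ge0.
have ts0 : 0 <= (t - s) ^+ 2 by rewrite sqr_ge0.
rewrite -leeBlDl ?fin_numM//; apply: le_ereal_inf_tmp => _ [pi piC <-].
rewrite leeBlDl ?fin_numM//.
have [<- _] := piC `]-oo, s]%classic (measurable_itv _).
have [_ <-] := piC `]-oo, t]%classic (measurable_itv _).
have mf : @measurable_fun _ _ (measurableTypeR R * measurableTypeR R)%type R setT
    (fun z => (z.1 - z.2) ^+ 2).
  by apply: measurable_funX; exact: measurable_funB.
pose A := (`]-oo, s] `*` `]t, +oo[ :
  set (measurableTypeR R * measurableTypeR R)%type).
pose B := (setT `*` `]-oo, t] :
  set (measurableTypeR R * measurableTypeR R)%type).
have mA : measurable A by exact: measurableX.
have mB : measurable B by exact: measurableX.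
have mC : measurable (`]-oo, s] `*` setT :
  set (measurableTypeR R * measurableTypeR R)%type) by exact: measurableX.
apply: (@le_trans _ _ (((t - s) ^+ 2)%:E * (pi B + pi A))%E).
  rewrite lee_wpmul2l ?lee_fin//.
  apply: le_trans (measureU2 _ mB mA).
  apply: le_measure; rewrite ?inE//; first exact: measurableU.
  move=> [x y] /= [xs _]; have [yt|ty] := leP y t.
    by left; split=> //=; rewrite in_itv.
  by right; split=> //=; rewrite in_itv/= ty.
rewrite ge0_muleDr ?measure_ge0// leeD2l//.
apply: lower_bound_le_integral => //= [z|[x y] []]; first exact: sqr_ge0.
rewrite /= !in_itv/= andbT => xs ty.
rewrite -(sqrrN (x - y)) opprB lerXn2r ?nnegrE ?subr_ge0 ?(ltW st)//.
  by rewrite (le_trans xs)// ltW// (lt_trans st).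
by rewrite lerB// ltW.
Qed.

End quantile_coupling.

(** * Images of laws under increasing bijections *)

Lemma W2_le_swap (R : realType) (m1 m2 : set R -> \bar R) :
  (W2 m1 m2 <= W2 m2 m1)%E.
Proof.
rewrite /W2 lee_sqrt; last first.
  apply: le_ereal_inf_tmp => _ [pi _ <-]; apply: integral_ge0 => x _.
  by rewrite lee_fin sqr_ge0.
apply: le_ereal_inf_tmp => _ [pi piC <-]; apply: ereal_inf_lbound.
have mswap := @measurable_swap _ _ (measurableTypeR R) (measurableTypeR R).
have [pi' pi'E] := pushforward_probability pi mswap.
exists pi'.
  move=> A mA; have [pi1 pi2] := piC A mA; rewrite pi'E /pushforward.
  by rewrite -pi1 -pi2; split; congr (pi _); apply/seteqP; split=> -[x y] /= [].
rewrite pi'E ge0_integral_pushforward//.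
- by apply: eq_integral => -[x y] _ /=; rewrite -sqrrN opprB.
- by apply/measurable_EFinP; apply: measurable_funX; exact: measurable_funB.
- by move=> z _; rewrite lee_fin sqr_ge0.
Qed.

Section intervals.
Context {R : realType}.

Lemma ooI_interval (a b : \bar R) : is_interval (ooI a b).
Proof.
move=> x y /andP[ax _] /andP[_ yb] z /andP[xz zy]; apply/andP; split.
  by apply: lt_le_trans ax _; rewrite lee_fin.
by apply: le_lt_trans yb; rewrite lee_fin.
Qed.

Lemma measurable_ooI (a b : \bar R) : measurable (ooI a b).
Proof. by apply: is_interval_measurable; exact: ooI_interval. Qed.

Lemma increasing_leE (D : set R) (f : R -> R) :
  {in D &, {homo f : x y / x < y}} ->
  forall x y, D x -> D y -> (f x <= f y) = (x <= y).
Proof.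
move=> homof x y Dx Dy; apply/idP/idP; last first.
  by rewrite !le_eqVlt => /predU1P[->|/homof->]; rewrite ?eqxx ?orbT// inE.
by apply: contraTT; rewrite -!ltNge; apply: homof; rewrite inE.
Qed.

Lemma increasing_measurable (D : set R) (f : R -> R) : is_interval D ->
  {in D &, {homo f : x y / x < y}} ->
  @measurable_fun _ _ (measurableTypeR R) (measurableTypeR R) D f.
Proof.
move=> itvD /increasing_leE leE.
apply: (measurability _ (RGenOInfty.measurableE R)).
move=> /= _ [_ [x ->] <-].
apply: is_interval_measurable => y z [Dy] /=; rewrite !in_itv/= !andbT => xfy [Dz xfz].
move=> w /andP[yw wz]; have Dw : D w by apply: (itvD y z) => //; rewrite yw.
by split=> //=; rewrite in_itv/= andbT (lt_le_trans xfy)// leE.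
Qed.

(** At the lower end, the distribution function vanishes up to [c]. At the upper end, if the
    quantile at [u] were at least [d], only levels at most [u] would be sent into the interval,
    whose mass would then be at most [u < 1]. *)
Lemma quantile_in_ooI (p : probability (measurableTypeR R) R) (c d : \bar R) u :
  p (ooI c d) = 1%E -> 0 < u < 1 -> ooI c d (quantile p u).
Proof.
move=> pI u01; have /andP[u0 u1] := u01.
set q := quantile p u.
have qF : u <= distribution_function p q.
  by have [_ <-//] := quantile_galois_pair p q.
rewrite /ooI/=; apply/andP; split.
  rewrite ltNge; apply/negP => qc; move: qF; apply/negP; rewrite -ltNge.
  rewrite -lte_fin distribution_functionE -(measureI_full _ _ pI)//; last first.
    exact: measurable_ooI.
  rewrite (_ : _ `&` _ = set0) ?measure0 ?lte_fin//.
  apply/seteqP; split=> x //= [] /andP[cx _]; rewrite in_itv/= => xq.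
  by have := lt_le_trans (le_lt_trans qc cx) (_ : x%:E <= q%:E)%E;
    rewrite lee_fin ltxx => /(_ xq).
rewrite ltNge; apply/negP => dq.
have mI : measurable (on_unit (quantile p) @^-1` ooI c d).
  rewrite -[X in measurable X]setTI.
  apply: (on_unit_measurable (quantile_galois_pair p)) => //.
  exact: measurable_ooI.
have : (unit_uniform (on_unit (quantile p) @^-1` ooI c d) <= u%:E)%E.
  rewrite -(unit_uniform_ray (v := u)); last by rewrite !ltW.
  rewrite -(measureI_full _ _ unit_uniform_itvoo)//.
  apply: le_measure; rewrite ?inE//=; first exact: measurableI.
  move=> v [] /=; rewrite !in_itv/= /on_unit => v01; rewrite v01 => /andP[_ vd].
  rewrite leNgt; apply/negP => uv; have /andP[_ v1] := v01.
  have := galois_pair_nondecreasing (quantile_galois_pair p) u0 (ltW uv) v1.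
  by rewrite -lee_fin leNgt (lt_le_trans vd dq).
rewrite on_unit_quantile; last exact: measurable_ooI.
by rewrite pI lee_fin leNgt u1.
Qed.

End intervals.

Section image_law.
Context {R : realType} (p : probability (measurableTypeR R) R).
Context (a b c d : \bar R) (f : R -> R).
Hypothesis pI : p (ooI c d) = 1%E.
Hypothesis f_bij : set_bij (ooI c d) (ooI a b) f.
Hypothesis f_incr : {in ooI c d &, {homo f : x y / x < y}}.

(** Extended by 0 outside the interval, [f] is measurable on the whole line, and the law is
    unchanged since the interval has full mass. *)
Lemma image_law_probability : exists q : probability (measurableTypeR R) R,
  forall A, measurable A -> image_law p (ooI c d) f A = q A.
Proof.
have mI := measurable_ooI c d.
have mf : @measurable_fun _ _ (measurableTypeR R) (measurableTypeR R) setT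
    (f \_ (ooI c d)).
  have [+ _] := @measurable_restrictT _ _ (measurableTypeR R) (measurableTypeR R)
    (ooI c d) f mI; apply; apply: increasing_measurable => //.
  exact: ooI_interval.
have [q qE] := pushforward_probability p mf.
exists q => A mA; rewrite qE /pushforward /image_law.
rewrite -[RHS](measureI_full _ _ pI)//; last first.
  by rewrite -[X in measurable X]setTI; exact: mf.
congr (p _); apply/seteqP; split=> x /= [Ix]; rewrite patchE mem_set//.
Qed.

Lemma quantile_image_law u : 0 < u < 1 ->
  quantile (image_law p (ooI c d) f) u = f (quantile p u).
Proof.
move=> u01; have /andP[u0 u1] := u01.
have Iq := quantile_in_ooI pI u01.
have leE := increasing_leE f_incr.
have [fI _ fS] := f_bij.
have uF x : (quantile p u <= x) = (u <= distribution_function p x).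
  by have [_ ->] := quantile_galois_pair p x.
rewrite {1}/quantile (_ : [set x | _] = `[f (quantile p u), +oo[); first exact: inf_itv.
have mle y : measurable (ooI c d `&` f @^-1` `]-oo, y]).
  by apply: (increasing_measurable (@ooI_interval _ _ _)) => //; exact: measurable_ooI.
apply/seteqP; split=> y /=; rewrite in_itv/= andbT => uy; last first.
  rewrite -lee_fin /distribution_function fineK; last first.
    by apply: fin_num_measure; exact: mle.
  have : (u%:E <= p `]-oo, quantile p u])%E.
    by rewrite -distribution_functionE lee_fin -uF.
  move=> /le_trans; apply; rewrite -(measureI_full _ _ pI)//; last exact: measurable_ooI.
  apply: le_measure; rewrite ?inE; [|exact: mle|].
    by apply: measurableI => //; exact: measurable_ooI.
  move=> x [Ix] /=; rewrite !in_itv/= => xq; split=> //=; rewrite ?in_itv/=.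
  by apply: le_trans uy; rewrite leE.
rewrite leNgt; apply/negP => yq; move: uy; apply/negP; rewrite -ltNge.
rewrite -lte_fin /distribution_function fineK; last first.
  by apply: fin_num_measure; exact: mle.
(* A value [y] at or below [a] has no image mass below it. Any other is some [f x], because
   [f (quantile p u)] keeps [y] below [b]. *)
have [ay|ya] := ltP a y%:E; last first.
  rewrite /image_law (_ : _ `&` _ = set0) ?measure0 ?lte_fin//.
  apply/seteqP; split=> x //= [] Ix; rewrite in_itv/= => fxy.
  have /andP[afx _] := fI _ Ix.
  by have := le_lt_trans ya afx; rewrite lte_fin ltNge fxy.
have [|x Ix xy] := fS y.
  apply/andP; split=> //; have /andP[_ /(lt_trans _)] := fI _ Iq; apply.
  by rewrite lte_fin.
apply: (@le_lt_trans _ _ (p `]-oo, x])).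
  apply: le_measure; rewrite ?inE//; first exact: mle.
  by move=> z [Iz] /=; rewrite !in_itv/= -xy leE.
rewrite -distribution_functionE lte_fin ltNge -uF -leE// -ltNge.
by rewrite xy.
Qed.

End image_law.

(** * Identifiability through the criterion *)

Lemma galois_pair_eq (R : realType) (Q Q' F : R -> R) :
  (forall u, 0 < u < 1 -> Q u = Q' u) -> galois_pair Q F -> galois_pair Q' F.
Proof. by move=> e QF x; have [? h] := QF x; split=> // u u01; rewrite -e ?h. Qed.

Lemma eq_on_unit (R : realType) (Q Q' : R -> R) :
  (forall u, 0 < u < 1 -> Q u = Q' u) -> on_unit Q = on_unit Q'.
Proof. by move=> e; apply/funext => u; rewrite /on_unit; case: ifP => // /e. Qed.

Lemma sqr_W2_ge0 (R : realType) (m1 m2 : set R -> \bar R) : (0 <= W2 m1 m2 ^+ 2)%E.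
Proof. by rewrite expe_ge0// /W2 sqrte_ge0. Qed.

Lemma eq_quantile (R : realType) (m1 m2 : set R -> \bar R) :
  (forall A, measurable A -> m1 A = m2 A) -> quantile m1 = quantile m2.
Proof.
move=> e; apply/funext => u; rewrite /quantile; congr inf.
by apply/seteqP; split=> x /=; rewrite /distribution_function e.
Qed.

Section criterion.
Context {R : realType} (J : nat) (J_gt0 : (0 < J)%N).
Context (phi : R -> R -> R) (a b c d : \bar R) (Lambda : set R).
Hypothesis phi_bij : forall l, Lambda l -> set_bij (ooI c d) (ooI a b) (phi l).
Hypothesis phi_incr : forall l, Lambda l ->
  {in ooI c d &, {homo phi l : x y / x < y}}.

Lemma criterion_ge0 (m : 'I_J -> set R -> \bar R) (theta : 'rV[R]_J) :
  (0 <= criterion phi (ooI c d) m theta)%E.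
Proof.
rewrite /criterion /mean_sqr_W2 mule_ge0 ?lee_fin ?invr_ge0//.
by apply: sume_ge0 => j _; exact: sqr_W2_ge0.
Qed.

(** Without separating points, all the transformed quantile functions coincide on ]0, 1[; the
    barycenter then shares them, and each quantile coupling has cost 0. *)
Lemma criterion0_or_separated (p : 'I_J -> probability (measurableTypeR R) R)
    (theta : 'rV[R]_J) :
  (forall j, p j (ooI c d) = 1%E) -> parameter_space Lambda theta ->
  criterion phi (ooI c d) (fun j => p j) theta = 0%E \/
  exists j k x y, [/\ ooI c d x, ooI c d y,
    phi (theta ord0 j) x < phi (theta ord0 k) y &
    distribution_function (p k) y < distribution_function (p j) x].
Proof.
move=> pI thetaL; pose f j := phi (theta ord0 j).
have f_incr j : {in ooI c d &, {homo f j : x y / x < y}} by exact: phi_incr.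
have f_bij j : set_bij (ooI c d) (ooI a b) (f j) by exact: phi_bij.
have [?|nosep] := pselect (exists j k x y, [/\ ooI c d x, ooI c d y, f j x < f k y &
  distribution_function (p k) y < distribution_function (p j) x]); first by right.
left.
have ineq j k u : 0 < u < 1 -> f k (quantile (p k) u) <= f j (quantile (p j) u).
  move=> u01; rewrite leNgt; apply/negP => jk; apply: nosep.
  have Ij := quantile_in_ooI (pI j) u01; have Ik := quantile_in_ooI (pI k) u01.
  have [fI _ fS] := f_bij k; have [fIj _ _] := f_bij j.
  (* The midpoint is pulled back by [f k] to a point [y] strictly below the [u]-quantile of [p k],
     so that the distribution function of [p k] at [y] is below [u], while that of [p j] at its own
     [u]-quantile is at least [u]. *)
  pose t := (f j (quantile (p j) u) + f k (quantile (p k) u)) / 2.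
  have [jt tk] := midf_lt jk.
  have [|y Iy yt] := fS t.
    apply: (ooI_interval (fIj _ Ij) (fI _ Ik)).
    by rewrite !ltW// /t midf_lt.
  exists j, k, (quantile (p j) u), y; split=> //; first by rewrite yt.
  have [_ Fk] := quantile_galois_pair (p k) y.
  have [_ Fj] := quantile_galois_pair (p j) (quantile (p j) u).
  apply: (@lt_le_trans _ _ u); last by rewrite -Fj.
  by rewrite ltNge -Fk// -(increasing_leE (f_incr k)) ?Iy// -ltNge yt.
have eqf j k u : 0 < u < 1 -> f j (quantile (p j) u) = f k (quantile (p k) u).
  by move=> u01; apply: le_anti; rewrite !ineq.
have /choice[q qE] : forall j, exists q : probability (measurableTypeR R) R,
    forall A, measurable A -> image_law (p j) (ooI c d) (f j) A = q A.
  by move=> j; exact: image_law_probability (pI j) (f_incr j).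
have qQ j u : 0 < u < 1 -> quantile (q j) u = f j (quantile (p j) u).
  move=> u01; rewrite -(eq_quantile (qE j)).
  by rewrite (quantile_image_law (pI j) (f_bij j) (f_incr j)).
rewrite /criterion /mean_sqr_W2; set nu := law_with_quantile _.
have [F QF] : exists F, galois_pair
    (fun u => J%:R^-1 * \sum_(k < J) f k (quantile (p k) u)) F.
  apply: sum_galois_pair => [|k]; first by rewrite invr_ge0.
  exact: galois_pair_eq (qQ k) (quantile_galois_pair (q k)).
have nuQ j u : 0 < u < 1 -> quantile nu u = quantile (q j) u.
  move=> u01; rewrite (galois_pair_law_with_quantile QF)// qQ//.
  rewrite (eq_bigr (fun=> f j (quantile (p j) u))); last by move=> k _; exact: eqf.
  rewrite sumr_const card_ord -[X in _ * X]mulr_natl mulrA mulVf ?mul1r//.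
  by rewrite pnatr_eq0 -lt0n.
rewrite big1 ?mule0// => j _.
apply: le_anti; rewrite sqr_W2_ge0 andbT.
apply: le_trans (W2_le_quantile (qE j) (fun _ _ => erefl)) _.
rewrite (eq_on_unit (nuQ j)) integral0_eq// => u _.
by rewrite subrr expr0n.
Qed.
End criterion.

(** * Empirical laws and empirical distribution functions *)

Definition ecdf (R : realType) (n : nat) (y : 'I_n -> R) (t : R) : R :=
  n%:R^-1 * \sum_(i < n) (y i <= t)%R%:R.

Lemma empirical_law_ray (R : realType) (n : nat) (y : 'I_n -> R) (t : R) :
  empirical_law y `]-oo, t] = (ecdf y t)%:E.
Proof.
rewrite /empirical_law /ecdf EFinM; congr (_ * _)%E.
rewrite -sumEFin; apply: eq_bigr => i _; rewrite diracE.
suff -> : (y i \in (`]-oo, t] : set R)) = (y i <= t) by [].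
by apply/idP/idP; rewrite inE/= in_itv.
Qed.

(** For [n > 0] the scaled sum of Dirac masses has total mass 1; [mnormalize] leaves it unchanged
    and only packages it as a probability. *)
Lemma empirical_law_probability (R : realType) (n : nat) (y : 'I_n -> R) :
  (0 < n)%N -> exists q : probability (measurableTypeR R) R,
    (forall A, q A = empirical_law y A) /\
    forall f : R -> R, measurable_fun setT f -> (forall x, 0 <= f x) ->
      (\int[q]_x (f x)%:E)%E = (n%:R^-1 * \sum_(i < n) f (y i))%:E.
Proof.
case: n y => // n y _.
have k0 : 0 <= (n.+1%:R^-1 : R) by rewrite invr_ge0.
(* [msum] runs over natural numbers, hence the passage through [inord]; only indices below [n.+1]
   contribute. *)
pose del i := @dirac _ (measurableTypeR R) (y (inord i)) R.
pose m : {measure set (measurableTypeR R) -> \bar R} :=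
  mscale (NngNum k0) (msum del n.+1).
have mE A : m A = empirical_law y A.
  rewrite /m /= /mscale /msum /empirical_law /=; congr (_ * _)%E.
  by apply: eq_bigr => i _; rewrite /del inord_val.
have m1 : m setT = 1%E.
  rewrite mE /empirical_law; rewrite (eq_bigr (fun=> 1%E)) => [|i _]; last exact: diracT.
  by rewrite sumEFin sumr_const card_ord -EFinM mulVf.
pose q : probability (measurableTypeR R) R :=
  mnormalize m (dirac (0 : measurableTypeR R)).
have qE : q = m :> (set (measurableTypeR R) -> \bar R).
  apply/funext => A; rewrite -[LHS]/(mnormalize m (dirac _) A) /mnormalize.
  by rewrite m1 onee_eq0 /= invr1 mule1.
exists q; split=> [A|f mf f0]; first by rewrite qE mE.
have mfE : measurable_fun setT (EFin \o f : measurableTypeR R -> \bar R).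
  exact/measurable_EFinP.
transitivity (\int[m]_x (f x)%:E)%E.
  by apply: eq_measure_integral => A _ _; exact: (congr1 (@^~ A) qE).
rewrite /m ge0_integral_mscale//; last first.
  by move=> x _; rewrite lee_fin.
rewrite ge0_integral_measure_sum//; last by move=> x _; rewrite lee_fin.
rewrite EFinM -sumEFin; congr (_ * _)%E; apply: eq_bigr => i _.
by rewrite /del integral_dirac// diracT mul1e inord_val.
Qed.

(** * Bounds on the empirical criterion *)

Lemma W2_ge0 (R : realType) (m1 m2 : set R -> \bar R) : (0 <= W2 m1 m2)%E.
Proof. by rewrite /W2 sqrte_ge0. Qed.

Section mean_sqr_W2.
Context {R : realType} (J : nat) (J_gt0 : (0 < J)%N).
Context (m : 'I_J -> set R -> \bar R) (mB : probability (measurableTypeR R) R).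

Lemma W2_le_mean_sqr j : (W2 (m j) mB ^+ 2 <= J%:R%:E * mean_sqr_W2 m mB)%E.
Proof.
rewrite /mean_sqr_W2 muleA -EFinM divff ?mul1e; last by rewrite pnatr_eq0 -lt0n.
rewrite (bigD1 j)//= leeDl// sume_ge0// => k _; exact: sqr_W2_ge0.
Qed.

(** [W2_ge_rays] is used twice, from [m j] to [mB] between [s] and [s + h], then from [mB] to [m k]
    between [s + h] and [s + 2 * h]; each squared distance is at most [J] times the mean. *)
Lemma mean_sqr_W2_ge_rays j k s h : 0 < h ->
  m k `]-oo, s + 2 * h] \is a fin_num ->
  ((h ^+ 2)%:E * m j `]-oo, s] <=
   (h ^+ 2)%:E * m k `]-oo, (s + 2 * h)%R] + (2 * J%:R)%:E * mean_sqr_W2 m mB)%E.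
Proof.
move=> h0 mkfin.
have := @W2_ge_rays _ (m j) mB s (s + h).
rewrite ltrDl => /(_ h0); rewrite addrAC subrr add0r.
move=> /(_ (fin_num_measure _ _ _)) /= h1.
apply: le_trans (h1 _) _; first exact: measurable_itv.
have := @W2_ge_rays _ mB (m k) (s + h) (s + 2 * h).
rewrite (_ : s + 2 * h - (s + h) = h); last by ring.
rewrite ltrD2l -[ltLHS]mul1r ltr_pM2r// ltr1n => /(_ isT mkfin) h2.
apply: le_trans (leeD2r _ h2) _.
rewrite -addeA leeD2l// (_ : 2 * J%:R = J%:R + J%:R); last by ring.
rewrite EFinD ge0_muleDl ?lee_fin//; apply: leeD; last exact: W2_le_mean_sqr.
apply: le_trans (W2_le_mean_sqr k).
by rewrite lee_sqr ?W2_ge0// W2_le_swap.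
Qed.

End mean_sqr_W2.

(** * Truncation and discretization of squared differences *)

Section discretization.
Context {R : realType}.
Implicit Types (M eta a b : R).

Definition clamp M a : R := Num.min (Num.max a (- M)) M.

(** A discretized position of [a], written with the indicators [a <= t] that integrate to
    distribution functions. *)
Definition grid_count M eta (n : nat) a : R :=
  \sum_(i < n) (a <= - M + i%:R * eta)%R%:R.

(** Each grid point at or above [a] accounts for one step of length [eta] between [a] and [M], up to
    one step of rounding. *)
Lemma clamp_grid_count M eta n a : 0 < M -> 0 < eta -> n%:R * eta = 2 * M ->
  M - eta * grid_count M eta n a - eta <= clamp M a
    <= M - eta * grid_count M eta n a.
Proof.
move=> M0 eta0 nM.
(* For the induction on the number of points, the cap [M] is replaced by [- M + k%:R * eta], which
   equals [M] at [k = n]. *)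
pose T (k : nat) := Num.min (Num.max a (- M)) (- M + k%:R * eta).
suff H k : - M + k%:R * eta - eta * grid_count M eta k a - eta <= T k
    <= - M + k%:R * eta - eta * grid_count M eta k a.
  have := H n; rewrite /T nM /clamp.
  by rewrite (_ : - M + 2 * M = M) //; ring.
elim: k => [|k]; rewrite /T /grid_count ?big_ord0 ?big_ord_recr/=.
  by rewrite mul0r mulr0 addr0 subr0 min_r ?le_max ?lexx ?orbT// gerBl ltW.
set S := \sum_(_ < _) _; have S0 : 0 <= S by apply: sumr_ge0.
set y := - M + k%:R * eta; have -> : - M + k.+1%:R * eta = y + eta.
  by rewrite /y -natr1; ring.
have My : - M <= y by rewrite /y lerDl mulr_ge0// ltW.
have [ay|ya] := leP a y.
  have ye : y <= y + eta by rewrite lerDl ltW.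
  have ey : Num.max a (- M) <= y by rewrite ge_max ay.
  rewrite (min_l ey) (min_l (le_trans ey ye)) => /andP[h1 h2].
  by rewrite (_ : true%:R = 1)//; apply/andP; split; lra.
rewrite (max_l (ltW (le_lt_trans My ya))) min_r ?(ltW ya)//.
rewrite (_ : false%:R = 0)// addr0 => /andP[h1 h2].
(* Here [a] is beyond [y], so the truncated value in the induction hypothesis is [y] itself, and its
   upper bound forces the count to vanish. *)
have eS : eta * S = 0.
  by apply/le_anti/andP; split; [lra|apply: mulr_ge0 => //; exact: ltW].
rewrite eS; apply/andP; split; last by rewrite ge_min subr0 lexx orbT.
by rewrite le_min; apply/andP; split; lra.
Qed.

Lemma clamp_bound M a : 0 < M -> - M <= clamp M a <= M.
Proof.
move=> M0; rewrite /clamp ge_min lexx orbT andbT le_min le_max lexx orbT/=.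
by lra.
Qed.

(** The error is zero when [a] lies between [- M] and [M]; otherwise its square and [M ^+ 2] are
    both at most [a ^+ 2]. *)
Lemma sqr_sub_clamp M a : 0 < M -> (a - clamp M a) ^+ 2 <= M ^- 2 * a ^+ 4.
Proof.
move=> M0; rewrite mulrC ler_pdivlMr ?exprn_gt0//.
have [aM|Ma] := leP a (- M).
  rewrite /clamp (max_r aM) min_l; last by lra.
  suff : (a - - M) ^+ 2 <= a ^+ 2 /\ M ^+ 2 <= a ^+ 2 by nra.
  split; nra.
have [aM|Ma'] := leP a M.
  by rewrite /clamp (max_l (ltW Ma)) min_l// subrr expr0n mul0r exprn_even_ge0.
rewrite /clamp (max_l (ltW Ma)) (min_r (ltW Ma')).
suff : (a - M) ^+ 2 <= a ^+ 2 /\ M ^+ 2 <= a ^+ 2 by nra.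
split; nra.
Qed.

(** The difference is split into two truncation errors, controlled by fourth powers, and a
    difference of truncated values. In the square of the latter, one factor is bounded by the range
    [2 * M] and the other by the grid. *)
Lemma sqr_dist_grid M eta n a b : 0 < M -> 0 < eta -> n%:R * eta = 2 * M ->
  (a - b) ^+ 2 <= 3 * M ^- 2 * (a ^+ 4 + b ^+ 4) + 12 * M * eta +
    6 * M * eta * \sum_(i < n)
      `|(a <= - M + i%:R * eta)%R%:R - (b <= - M + i%:R * eta)%R%:R|.
Proof.
move=> M0 eta0 nM.
have /andP[a1 a2] := clamp_grid_count a M0 eta0 nM.
have /andP[b1 b2] := clamp_grid_count b M0 eta0 nM.
have /andP[a3 a4] := clamp_bound a M0.
have /andP[b3 b4] := clamp_bound b M0.
have aM := sqr_sub_clamp a M0.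
have bM := sqr_sub_clamp b M0.
set D := \sum_(i < n) _.
have D1 : `|grid_count M eta n a - grid_count M eta n b| <= D.
  by rewrite /grid_count -sumrB; exact: ler_norm_sum.
have D2 : `|clamp M a - clamp M b| <= eta + eta * D.
  move: D1; rewrite !ler_norml => /andP[D1 D2].
  by apply/andP; split; nra.
have D3 : (clamp M a - clamp M b) ^+ 2 <= 2 * M * (eta + eta * D).
  rewrite -real_normK ?num_real// expr2.
  apply: ler_pM => //; rewrite ler_norml; apply/andP; split; lra.
have : (a - b) ^+ 2 <= 3 * (a - clamp M a) ^+ 2 + 3 * (b - clamp M b) ^+ 2 +
  3 * (clamp M a - clamp M b) ^+ 2.
  rewrite -subr_ge0; set p := clamp M a; set q := clamp M b.
  (* With [a - b] written as [(a - p) - (b - q) + (p - q)], three times the sum of the squares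
     exceeds the square of the sum by exactly these three squares. *)
  have : 0 <= ((a - p) + (b - q)) ^+ 2 + ((a - p) - (p - q)) ^+ 2 + ((b - q) + (p - q)) ^+ 2.
    by rewrite !addr_ge0 ?sqr_ge0.
  by congr (_ <= _); ring.
have D0 : 0 <= D by apply: sumr_ge0.
nra.
Qed.

End discretization.

(** * Integrated squared distance between quantile functions *)

Section quantile_distance.
Context {R : realType}.
Implicit Types p : probability (measurableTypeR R) R.

Lemma measurable_on_unit_quantile p :
  @measurable_fun _ _ (measurableTypeR R) R setT (on_unit (quantile p)).
Proof. exact: on_unit_measurable (quantile_galois_pair p). Qed.

Lemma measurable_on_unit_quantile_le p x :
  @measurable_fun _ _ (measurableTypeR R) R setT
    (fun u => (on_unit (quantile p) u <= x)%R%:R).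
Proof.
rewrite (_ : (fun u => _) = \1_(on_unit (quantile p) @^-1` `]-oo, x])).
  apply: measurable_indic; rewrite -[X in measurable X]setTI.
  exact: measurable_on_unit_quantile.
apply/funext => u; rewrite indicE.
suff -> : (u \in on_unit (quantile p) @^-1` `]-oo, x]) = (on_unit (quantile p) u <= x) by [].
by apply/idP/idP; rewrite inE/= in_itv.
Qed.

(** By the Galois connection the indicators are those of [u <= F1] and [u <= F2]; they differ only
    between [F1] and [F2]. Outside ]0, 1[ both quantities are the default value and cancel. *)
Lemma integral_quantile_le p1 p2 x :
  (\int[unit_uniform]_u
    `|(on_unit (quantile p1) u <= x)%R%:R - (on_unit (quantile p2) u <= x)%R%:R|%:E
  <= `|distribution_function p1 x - distribution_function p2 x|%:E)%E.
Proof.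
wlog F12 : p1 p2 / distribution_function p1 x <= distribution_function p2 x.
  move=> H; have [|/ltW F21] := leP (distribution_function p1 x) (distribution_function p2 x).
    exact: H.
  rewrite distrC; under eq_integral do rewrite distrC.
  exact: H.
set F1 := distribution_function p1 x; set F2 := distribution_function p2 x.
pose A : set (measurableTypeR R) := `]0, 1[ `&` `]F1, F2].
have mA : measurable A by exact: measurableI.
rewrite (eq_integral (fun u => (\1_A u)%:E)); last first.
  move=> u _; rewrite indicE /on_unit; congr (_%:E).
  have [u01|u01] := ifPn.
    have [_ e1] := quantile_galois_pair p1 x; rewrite (e1 _ u01).
    have [_ e2] := quantile_galois_pair p2 x; rewrite (e2 _ u01).
    have -> : (u \in A) = (F1 < u <= F2).
      by apply/idP/idP; rewrite inE /A /= !in_itv/=; [case|move=> ->].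
    rewrite -/F1 -/F2; have [uF1|F1u] := leP u F1.
      by rewrite (le_trans uF1 F12) subrr normr0.
    by rewrite (_ : false%:R = 0 :> R)// sub0r normrN ger0_norm.
  rewrite subrr normr0; have -> // : (u \in A) = false.
  by apply/negbTE; rewrite notin_setE /A /= in_itv/= => -[u01' _]; rewrite u01' in u01.
rewrite integral_indic// setIT.
rewrite ler0_norm ?subr_le0// opprB EFinB leeBrDr//.
have F101 := distribution_function_itv01 p1 x.
have F201 := distribution_function_itv01 p2 x.
rewrite -(unit_uniform_ray F101) -(unit_uniform_ray F201).
rewrite -measureU//; last first.
  apply/seteqP; split=> u //=; rewrite /A /= !in_itv/= => -[[_ /andP[F1u _]]].
  by rewrite leNgt F1u.
apply: le_measure; rewrite ?inE//; first exact: measurableU.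
move=> u; rewrite /A /= !in_itv/= => -[[_ /andP[]//]|/le_trans]; exact.
Qed.

Lemma ge0_integral_on_unit_quantile p (f : R -> R) :
  measurable_fun setT f -> (forall x, 0 <= f x) ->
  (\int[unit_uniform]_u (f (on_unit (quantile p) u))%:E = \int[p]_x (f x)%:E)%E.
Proof.
move=> mf f0; have mQ := on_unit_measurable (quantile_galois_pair p).
have [q qE] := pushforward_probability unit_uniform mQ.
transitivity (\int[q]_x (f x)%:E)%E; last first.
  apply: eq_measure_integral => A mA _.
  exact: etrans (congr1 (@^~ A) qE) (on_unit_quantile p mA).
rewrite qE ge0_integral_pushforward//.
- exact/measurable_EFinP.
- by move=> x _; rewrite lee_fin.
Qed.

(** [sqr_dist_grid] is integrated along the quantile coupling. The [n] grid points contribute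
    [6 * M * eta * (n%:R * delta)], which is the last term since [n%:R * eta = 2 * M]. *)
Lemma integral_sqr_quantile_le p1 p2 (M eta delta A1 A2 : R) (n : nat) :
  0 < M -> 0 < eta -> n%:R * eta = 2 * M ->
  (\int[p1]_x (x ^+ 4)%:E = A1%:E)%E -> (\int[p2]_x (x ^+ 4)%:E = A2%:E)%E ->
  (forall i : 'I_n, `|distribution_function p1 (- M + i%:R * eta) -
    distribution_function p2 (- M + i%:R * eta)| <= delta) ->
  (\int[unit_uniform]_u
    ((on_unit (quantile p1) u - on_unit (quantile p2) u) ^+ 2)%:E <=
  (3 * M ^- 2 * (A1 + A2) + 12 * M * eta + 12 * M ^+ 2 * delta)%:E)%E.
Proof.
move=> M0 eta0 nM pA1 pA2 Fd.
set Q1 := on_unit (quantile p1); set Q2 := on_unit (quantile p2).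
have mQ1 : @measurable_fun _ _ (measurableTypeR R) R setT Q1.
  exact: measurable_on_unit_quantile.
have mQ2 : @measurable_fun _ _ (measurableTypeR R) R setT Q2.
  exact: measurable_on_unit_quantile.
pose d (i : 'I_n) u : R :=
  `|(Q1 u <= - M + i%:R * eta)%R%:R - (Q2 u <= - M + i%:R * eta)%R%:R|.
have md i : measurable_fun setT (d i).
  apply: measurableT_comp => //; apply: measurable_funB;
  exact: measurable_on_unit_quantile_le.
pose c1 := 3 * M ^- 2; have c10 : 0 <= c1 by rewrite mulr_ge0// invr_ge0 sqr_ge0.
pose c3 := 6 * M * eta; have c30 : 0 <= c3 by rewrite !mulr_ge0// ltW.
pose c2 := 12 * M * eta; have c20 : 0 <= c2 by rewrite !mulr_ge0// ltW.
apply: (@le_trans _ _ (\int[unit_uniform]_u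
   (c1%:E * ((Q1 u ^+ 4)%:E + (Q2 u ^+ 4)%:E) + c2%:E +
    c3%:E * \sum_(i < n) (d i u)%:E)))%E.
  apply: ge0_le_integral => //.
  - by move=> u _; rewrite lee_fin sqr_ge0.
  - apply/measurable_EFinP; apply: measurable_funX; exact: measurable_funB.
  - apply: emeasurable_funD; last first.
      apply: measurable_funeM; apply: emeasurable_sum => i.
      by apply/measurable_EFinP; exact: md.
    apply: emeasurable_funD => //; apply: measurable_funeM.
    by apply: emeasurable_funD; apply/measurable_EFinP; exact: measurable_funX.
  - move=> u _; rewrite sumEFin -!EFinD lee_fin.
    exact: sqr_dist_grid.
have mX p : measurable_fun setT (fun u => (on_unit (quantile p) u ^+ 4)%:E : \bar R).
  apply/measurable_EFinP/measurable_funX; exact: measurable_on_unit_quantile.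
have X0 p u : (0 <= (on_unit (quantile p) u ^+ 4)%:E)%E.
  by rewrite lee_fin exprn_even_ge0.
have md' i : measurable_fun setT (fun u => (d i u)%:E).
  by apply/measurable_EFinP; exact: md.
have d0 i u : (0 <= (d i u)%:E)%E by rewrite lee_fin /d normr_ge0.
have intX p : (\int[unit_uniform]_u (on_unit (quantile p) u ^+ 4)%:E =
    \int[p]_x (x ^+ 4)%:E)%E.
  apply: (ge0_integral_on_unit_quantile p (f := fun x => x ^+ 4)).
    by apply: measurable_funX.
  by move=> x; rewrite exprn_even_ge0.
have mS : measurable_fun setT (fun u => \sum_(i < n) (d i u)%:E)%E.
  by apply: emeasurable_sum => i; exact: md'.
have S0 u : (0 <= \sum_(i < n) (d i u)%:E)%E by apply: sume_ge0.
have m1 : measurable_fun setT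
    (fun u => c1%:E * ((Q1 u ^+ 4)%:E + (Q2 u ^+ 4)%:E))%E.
  by apply: measurable_funeM; apply: emeasurable_funD; exact: mX.
have p1_0 u : (0 <= c1%:E * ((Q1 u ^+ 4)%:E + (Q2 u ^+ 4)%:E))%E.
  by apply: mule_ge0; [rewrite lee_fin|apply: adde_ge0; exact: X0].
rewrite ge0_integralD//; first last.
- exact: measurable_funeM.
- by move=> u _; apply: mule_ge0.
- by apply: emeasurable_funD.
- by move=> u _; apply: adde_ge0.
rewrite ge0_integralD//.
rewrite ge0_integralZl_EFin//; first last.
- by apply: emeasurable_funD; exact: mX.
- by move=> u _; apply: adde_ge0; exact: X0.
rewrite ge0_integralD//; last 4 first.
- by move=> u _; exact: X0.
- exact: mX.
- by move=> u _; exact: X0.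
- exact: mX.
rewrite !intX pA1 pA2 integral_cst_probability.
rewrite ge0_integralZl_EFin// ge0_integral_sum//.
apply: (@le_trans _ _ (c1%:E * (A1%:E + A2%:E) + c2%:E +
    c3%:E * \sum_(i < n) delta%:E)%E).
  rewrite leeD2l// lee_wpmul2l ?lee_fin//; apply: lee_sum => i _.
  apply: le_trans (integral_quantile_le _ _ _) _.
  by rewrite lee_fin.
rewrite sumEFin -!EFinD lee_fin sumr_const card_ord -[delta *+ n]mulr_natl /c1 /c2 /c3.
rewrite lerD2l le_eqVlt; apply/orP; left; apply/eqP.
rewrite (_ : 6 * M * eta * (n%:R * delta) = 6 * M * (n%:R * eta) * delta); last by ring.
by rewrite nM; ring.
Qed.

End quantile_distance.

(** Jensen's inequality, from the nonnegativity of the sum of squared deviations from the mean. *)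
Lemma sqr_mean_le (R : realFieldType) (J : nat) (b : 'I_J -> R) : (0 < J)%N ->
  (J%:R^-1 * \sum_(k < J) b k) ^+ 2 <= J%:R^-1 * \sum_(k < J) b k ^+ 2.
Proof.
move=> J0; have JR : 0 < J%:R :> R by rewrite ltr0n.
set S := \sum_(k < J) b k; set s := J%:R^-1 * S.
have Ss : S = J%:R * s by rewrite /s mulrA divff ?mul1r// gt_eqF.
have : 0 <= \sum_(k < J) (b k - s) ^+ 2 by apply: sumr_ge0 => k _; exact: sqr_ge0.
rewrite (eq_bigr (fun k => b k ^+ 2 - (2 * s * b k - s ^+ 2))); last first.
  by move=> k _; ring.
rewrite sumrB sumrB -mulr_sumr -/S sumr_const card_ord -[s ^+ 2 *+ J]mulr_natl Ss.
move=> h; rewrite -(ler_pM2l JR) [leRHS]mulrA divff ?mul1r ?gt_eqF//.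
by nra.
Qed.

Section empirical_criterion.
Context {R : realType} (J : nat) (J_gt0 : (0 < J)%N).
Context (phi : R -> R -> R) (n : nat) (n_gt0 : (0 < n)%N).
Context (x : nat -> 'I_J -> R) (theta : 'rV[R]_J).

Let y (j : 'I_J) (i : 'I_n) := phi (theta ord0 j) (x i j).

Lemma empirical_criterion_ge j k (s h delta : R) : 0 < h -> 0 <= delta ->
  delta <= ecdf (y j) s - ecdf (y k) (s + 2 * h) ->
  ((h ^+ 2 * delta / (2 * J%:R))%:E <= empirical_criterion phi n x theta)%E.
Proof.
move=> h0 d0 dF; have JR : 0 < 2 * J%:R :> R by rewrite mulr_gt0// ltr0n.
rewrite /empirical_criterion; set nu := law_with_quantile _.
have mE j' t : empirical_law (y j') `]-oo, t] = (ecdf (y j') t)%:E.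
  exact: empirical_law_ray.
have := @mean_sqr_W2_ge_rays _ _ J_gt0 (fun j => empirical_law (y j)) nu j k s h h0.
rewrite !mE => /(_ isT).
rewrite -leeBlDl// -EFinB -mulrBr => H.
rewrite EFinM muleC lee_pdivrMl//; apply: le_trans H.
by rewrite lee_fin ler_wpM2l ?sqr_ge0.
Qed.

(** The quantile function of the barycenter is the average of the empirical ones, so by Jensen's
    inequality its squared distance to one of them is at most the mean of the pairwise costs
    [D j k]. *)
Lemma empirical_criterion_le (M eta delta C : R) (N : nat) :
  0 < M -> 0 < eta -> N%:R * eta = 2 * M ->
  (forall j, n%:R^-1 * \sum_(i < n) y j i ^+ 4 <= C) ->
  (forall (i : 'I_N) j k, `|ecdf (y j) (- M + i%:R * eta) -
    ecdf (y k) (- M + i%:R * eta)| <= delta) ->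
  (empirical_criterion phi n x theta <=
    (6 * M ^- 2 * C + 12 * M * eta + 12 * M ^+ 2 * delta)%:E)%E.
Proof.
move=> M0 eta0 NM yC yd; have JR : 0 < J%:R :> R by rewrite ltr0n.
set B := 6 * _ * C + _ + _.
have /choice[q qE] j : exists q : probability (measurableTypeR R) R,
    (forall A, q A = empirical_law (y j) A) /\
    forall f : R -> R, measurable_fun setT f -> (forall x, 0 <= f x) ->
      (\int[q]_x (f x)%:E)%E = (n%:R^-1 * \sum_(i < n) f (y j i))%:E.
  exact: empirical_law_probability.
have qq j : quantile (q j) = quantile (empirical_law (y j)).
  by apply: eq_quantile => A _; exact: (qE j).1.
have qF j t : distribution_function (q j) t = ecdf (y j) t.
  by rewrite /distribution_function (qE j).1 empirical_law_ray.
rewrite /empirical_criterion; set nu := law_with_quantile _.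
have [F QF] : exists F, galois_pair (fun u => J%:R^-1 * \sum_(k < J)
    quantile (empirical_law (y k)) u) F.
  apply: sum_galois_pair => [|k]; first by rewrite invr_ge0.
  by rewrite -qq; exact: quantile_galois_pair.
pose D j k := (\int[unit_uniform]_u
  ((on_unit (quantile (q j)) u - on_unit (quantile (q k)) u) ^+ 2)%:E)%E.
have DB j k : (D j k <= B%:E)%E.
  have q4 l : (\int[q l]_x (x ^+ 4)%:E)%E = (n%:R^-1 * \sum_(i < n) y l i ^+ 4)%:E.
    apply: (qE l).2 => [|z]; first exact: measurable_funX.
    by rewrite exprn_even_ge0.
  apply: le_trans (integral_sqr_quantile_le M0 eta0 NM (q4 j) (q4 k) _) _.
    by move=> i; rewrite !qF; exact: yd.
  rewrite lee_fin /B !lerD2r (_ : 6 * M ^- 2 * C = 3 * M ^- 2 * (C + C)); last by ring.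
  rewrite ler_wpM2l// ?lerD// mulr_ge0// invr_ge0 sqr_ge0//.
have W2B j : (W2 (empirical_law (y j)) nu ^+ 2 <= B%:E)%E.
  apply: (@le_trans _ _ (\int[unit_uniform]_u
      ((on_unit (quantile (q j)) u - on_unit (quantile nu) u) ^+ 2)%:E)%E).
    by apply: W2_le_quantile => // A _; rewrite (qE j).1.
  apply: (@le_trans _ _ (J%:R^-1%:E * \sum_(k < J) D j k)%E); last first.
    rewrite lee_pdivrMl//; apply: (@le_trans _ _ (\sum_(k < J) B%:E)%E).
      exact: lee_sum.
    by rewrite sumEFin sumr_const card_ord -EFinM mulr_natl.
  have mQ l : @measurable_fun _ _ (measurableTypeR R) R setT
    (on_unit (quantile (q l))) by exact: measurable_on_unit_quantile.
  have mD k : measurable_fun setT (fun u =>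
      ((on_unit (quantile (q j)) u - on_unit (quantile (q k)) u) ^+ 2)%:E : \bar R).
    by apply/measurable_EFinP/measurable_funX/measurable_funB; exact: mQ.
  have D0 k u : (0 <= ((on_unit (quantile (q j)) u -
      on_unit (quantile (q k)) u) ^+ 2)%:E)%E by rewrite lee_fin sqr_ge0.
  rewrite -ge0_integral_sum// -ge0_integralZl_EFin//; first last.
  - by apply: emeasurable_sum.
  - by move=> u _; apply: sume_ge0.
  apply: ge0_le_integral => //.
  - by move=> u _; rewrite lee_fin sqr_ge0.
  - apply/measurable_EFinP/measurable_funX/measurable_funB; first exact: mQ.
    exact: measurable_on_unit_quantile.
  - by apply: measurable_funeM; apply: emeasurable_sum.
  move=> u _; rewrite sumEFin -EFinM lee_fin.
  rewrite /on_unit; case: ifPn => [u01|_]; last first.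
    by rewrite subrr expr0n mulr_ge0// ?invr_ge0// sumr_ge0// => k _; exact: sqr_ge0.
  rewrite (galois_pair_law_with_quantile QF u01).
  set z := quantile (q j) u.
  have -> : z - J%:R^-1 * \sum_(k < J) quantile (empirical_law (y k)) u =
      J%:R^-1 * \sum_(k < J) (z - quantile (q k) u).
    rewrite sumrB sumr_const card_ord mulrBr -[z *+ J]mulr_natl mulrA mulVf ?mul1r ?gt_eqF//.
    by congr (_ - _ * _); apply: eq_bigr => k _; rewrite qq.
  exact: sqr_mean_le.
rewrite /mean_sqr_W2 lee_pdivrMl//; apply: (@le_trans _ _ (\sum_(j < J) B%:E)%E).
  by apply: lee_sum => j _; exact: W2B.
by rewrite sumEFin sumr_const card_ord -EFinM mulr_natl.
Qed.

End empirical_criterion.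

(** * Events of inner probability tending to one *)

Lemma measurable_superlevel d (T : measurableType d) (R : realType)
    (f : T -> R) (c : R) :
  measurable_fun setT f -> measurable [set w | c <= f w].
Proof.
move=> mf; rewrite (_ : [set w | _] = f @^-1` `[c, +oo[).
  by rewrite -[X in measurable X]setTI; exact: mf.
by apply/seteqP; split=> w /=; rewrite in_itv/= andbT.
Qed.

Section likely.
Context d (T : measurableType d) (R : realType) (P : probability T R).
Implicit Types Q : nat -> set T.

(* [Q n] has inner probability tending to 1; no measurability of [Q n] is
   required. *)
Definition likely Q := forall rho : R, 0 < rho -> exists B : nat -> set T,
  [/\ forall n, measurable (B n), \forall n \near \oo, (P (B n) <= rho%:E)%E &
      forall n, ~` B n `<=` Q n].

Lemma likely_sub Q Q' : (forall n, Q n `<=` Q' n) -> likely Q -> likely Q'.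
Proof.
move=> QQ' lQ rho rho0; have [B [mB PB BQ]] := lQ rho rho0.
by exists B; split=> // n; exact: subset_trans (BQ n) (QQ' n).
Qed.

Lemma likelyI Q Q' : likely Q -> likely Q' -> likely (fun n => Q n `&` Q' n).
Proof.
move=> lQ lQ' rho rho0; have rho2 : 0 < rho / 2 by rewrite divr_gt0.
have [B [mB PB BQ]] := lQ _ rho2; have [B' [mB' PB' BQ']] := lQ' _ rho2.
exists (fun n => B n `|` B' n); split => [n| |n w].
- exact: measurableU.
- near=> n; apply: le_trans (measureU2 _ (mB n) (mB' n)) _.
  rewrite [in leRHS](splitr rho) EFinD; apply: leeD; near: n => //.
- rewrite setCU => -[nB nB']; split; [exact: BQ|exact: BQ'].
Unshelve. all: by end_near. Qed.

Lemma likely_forall_seq (I : eqType) (s : seq I) (Q : I -> nat -> set T) :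
  (forall i, likely (Q i)) ->
  likely (fun n w => forall i, i \in s -> Q i n w).
Proof.
move=> lQ; elim: s => [|i s IH].
  move=> rho rho0; exists (fun=> set0); split=> //; near=> n.
  by rewrite measure0 lee_fin ltW.
apply: likely_sub (likelyI (lQ i) IH) => n w [Qi Qs] k.
by rewrite inE => /predU1P[->//|]; exact: Qs.
Unshelve. all: by end_near. Qed.

Lemma likely_forall (I : finType) (Q : I -> nat -> set T) :
  (forall i, likely (Q i)) -> likely (fun n w => forall i, Q i n w).
Proof.
move=> lQ; apply: likely_sub (likely_forall_seq (enum I) lQ) => n w H i.
by apply: H; rewrite mem_enum.
Qed.

Lemma likely_ae (W : set T) : {ae P, forall w, W w} -> likely (fun=> W).
Proof.
move=> [N [mN PN0 WN]] rho rho0; exists (fun=> N); split=> // [|n].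
  by near=> n; rewrite PN0 lee_fin ltW.
by move=> w; apply: contra_notP => nW; exact: WN.
Unshelve. all: by end_near. Qed.

(** Lets deterministic conditions such as [0 < n] be intersected with random events. *)
Lemma likely_near (A : set nat) : (\forall n \near \oo, A n) ->
  likely (fun n _ => A n).
Proof.
move=> nA rho rho0.
exists (fun n => if `[< A n >] then set0 else setT); split=> [n| |n w].
- by case: ifP.
- near=> n; have An : A n by near: n.
  by rewrite (asboolT An) measure0 lee_fin ltW.
- by case: ifPn => [/asboolP//|_]; rewrite setCT.
Unshelve. all: by end_near. Qed.

Lemma likely_probability_le Q (E : nat -> set T) (rho : R) : likely Q ->
  (forall n, measurable (E n)) -> (forall n w, E n w -> ~ Q n w) -> 0 < rho ->
  \forall n \near \oo, (P (E n) <= rho%:E)%E.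
Proof.
move=> lQ mE EQ rho0; have [B [mB PB BQ]] := lQ rho rho0.
near=> n; apply: (@le_trans _ _ (P (B n))); last by near: n.
by apply: le_measure; rewrite ?inE// => w /EQ; apply: contra_notP => /BQ.
Unshelve. all: by end_near. Qed.

End likely.

(** * Weak law of large numbers for frequencies *)

Section law_of_large_numbers.
Context d (T : measurableType d) (R : realType) (P : probability T R).
Context (E : nat -> set T) (p : R).
Hypothesis mE : forall i, measurable (E i).
Hypothesis PE : forall i, P (E i) = p%:E.
Hypothesis PEE : forall i k, i != k -> P (E i `&` E k) = (p * p)%:E.

Let S n (w : T) : R := \sum_(i < n) \1_(E i) w.

Lemma measurable_frequency_deviation n (delta : R) :
  measurable [set w | (delta <= `|n%:R^-1 * S n w - p|)%R].
Proof.
apply: measurable_superlevel; apply: measurableT_comp => //.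
apply: measurable_funB => //; apply: measurable_funM => //.
by apply: measurable_sum => i; exact: measurable_indic.
Qed.

(** Chebyshev's inequality for the number of occurrences, whose variance is at most [n] by pairwise
    independence. *)
Lemma frequency_probability_le n (delta : R) : (0 < n)%N -> 0 < delta ->
  (P [set w | (delta <= `|n%:R^-1 * S n w - p|)%R] <= (n%:R^-1 / delta ^+ 2)%:E)%E.
Proof.
move=> n0 delta0; have nR : 0 < n%:R :> R by rewrite ltr0n.
have p0 : 0 <= p by rewrite -lee_fin -(PE 0).
have p1 : p <= 1 by rewrite -lee_fin -(PE 0) probability_le1.
have mI i : measurable_fun setT (\1_(E i) : T -> R) by exact: measurable_indic.
have mII i k : measurable_fun setT (fun w => \1_(E i) w * \1_(E k) w : R).
  exact: measurable_funM.
have I0 i k w : 0 <= \1_(E i) w * \1_(E k) w :> R by rewrite !indicE mulr_ge0.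
have mS : measurable_fun setT (S n) by exact: measurable_sum.
have S0 w : 0 <= S n w by apply: sumr_ge0 => i _; rewrite indicE.
have intS : (\int[P]_w (S n w)%:E = (n%:R * p)%:E)%E.
  under eq_integral do rewrite -sumEFin.
  rewrite ge0_integral_sum//; last first.
    by move=> i; apply/measurable_EFinP.
  have intI (i : 'I_n) : (\int[P]_w (\1_(E i) w)%:E = p%:E)%E.
    by rewrite integral_indic// setIT; exact: PE.
  rewrite (eq_bigr _ (fun i _ => intI i)).
  by rewrite sumEFin sumr_const card_ord mulr_natl.
(* In the expanded square, the [n] diagonal terms have expectation [p] and the others [p ^+ 2]; the
   latter are counted [n ^ 2] times, which is enough for an upper bound. *)
have intS2 : (\int[P]_w (S n w ^+ 2)%:E <= (n%:R * p + n%:R ^+ 2 * p ^+ 2)%:E)%E.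
  under eq_integral => w _.
    rewrite expr2 {1}/S mulr_suml -sumEFin.
    under eq_bigr do rewrite mulr_sumr -sumEFin.
    over.
  rewrite ge0_integral_sum//; last 2 first.
  - by move=> i; apply: emeasurable_sum => k; apply/measurable_EFinP.
  - by move=> i w _; apply: sume_ge0 => k _; rewrite lee_fin.
  have -> : n%:R * p + n%:R ^+ 2 * p ^+ 2 = \sum_(i < n) (p + n%:R * p ^+ 2).
    by rewrite sumr_const card_ord -[RHS]mulr_natl; ring.
  rewrite -sumEFin; apply: lee_sum => i _.
  rewrite ge0_integral_sum//; last by move=> k; apply/measurable_EFinP.
  have intEE (k : 'I_n) : (\int[P]_w (\1_(E i) w * \1_(E k) w)%:E = P (E i `&` E k))%E.
    rewrite -(setIT (E i `&` E k)) -integral_indic//; last exact: measurableI.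
    by apply: eq_integral => w _; rewrite indicI.
  rewrite (eq_bigr _ (fun k _ => intEE k)) (bigD1 i)//= setIid PE EFinD leeD2l//.
  apply: (@le_trans _ _ (\sum_(k < n | k != i) (p * p)%:E)%E).
    by apply: lee_sum => k ki; rewrite PEE// eq_sym.
  rewrite sumEFin lee_fin.
  apply: (@le_trans _ _ (\sum_(k < n) (p * p))).
    by rewrite [leRHS](bigD1 i)//= lerDr mulr_ge0.
  by rewrite sumr_const card_ord -[_ *+ n]mulr_natl expr2.
have var : (\int[P]_w ((S n w - n%:R * p) ^+ 2)%:E <= n%:R%:E)%E.
  set V := (\int[P]_w _)%E.
  (* The cross term of the square is moved to the left so that all the
     integrands are nonnegative. *)
  have : (V + (2 * n%:R * p * (n%:R * p))%:E =
      \int[P]_w (S n w ^+ 2)%:E + (n%:R ^+ 2 * p ^+ 2)%:E)%E.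
    transitivity (\int[P]_w (((S n w - n%:R * p) ^+ 2)%:E +
        (2 * n%:R * p)%:E * (S n w)%:E))%E.
      rewrite ge0_integralD//.
      - rewrite ge0_integralZl_EFin// ?intS//.
        + by move=> w _; rewrite lee_fin.
        + exact/measurable_EFinP.
        + by rewrite !mulr_ge0.
      - by move=> w _; rewrite lee_fin sqr_ge0.
      - by apply/measurable_EFinP; apply: measurable_funX; exact: measurable_funB.
      - by move=> w _; rewrite -EFinM lee_fin !mulr_ge0.
      - by apply: measurable_funeM; apply/measurable_EFinP.
    transitivity (\int[P]_w ((S n w ^+ 2)%:E + (n%:R ^+ 2 * p ^+ 2)%:E))%E.
      apply: eq_integral => w _; rewrite -EFinM -!EFinD; congr (_%:E); ring.
    rewrite ge0_integralD//.
    - by rewrite integral_cst_probability.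
    - by move=> w _; rewrite lee_fin sqr_ge0.
    - by apply/measurable_EFinP; apply: measurable_funX.
    - by move=> w _; rewrite lee_fin mulr_ge0 ?sqr_ge0.
  move=> VE; rewrite -(@leeD2rE _ (2 * n%:R * p * (n%:R * p))%:E)// VE.
  apply: (le_trans (leeD2r _ intS2)); rewrite -!EFinD lee_fin.
  have : n%:R * p <= n%:R by rewrite ler_piMr// ltW.
  by lra.
have mA := measurable_frequency_deviation n delta.
have c0 : 0 < (delta * n%:R) ^+ 2 by rewrite exprn_gt0// mulr_gt0.
have := @lower_bound_le_integral _ _ _ P (fun w => (S n w - n%:R * p) ^+ 2)
  _ ((delta * n%:R) ^+ 2) _ (fun=> sqr_ge0 _) mA (ltW c0) _.
move=> /(_ _ _)/le_trans => H.
have {H} : (((delta * n%:R) ^+ 2)%:E *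
    P [set w | (delta <= `|n%:R^-1 * S n w - p|)%R] <= n%:R%:E)%E.
  apply: H var => [|w /= dS].
    by apply: measurable_funX; exact: measurable_funB.
  rewrite -[leRHS]real_normK ?num_real// lerXn2r ?nnegrE ?mulr_ge0 ?(ltW delta0)//.
  have -> : S n w - n%:R * p = n%:R * (n%:R^-1 * S n w - p).
    by rewrite mulrBr mulrA divff ?gt_eqF// mul1r.
  by rewrite normrM ger0_norm// mulrC ler_pM2l.
rewrite -lee_pdivlMl//; move=> /le_trans; apply.
rewrite -EFinM lee_fin exprMn le_eqVlt; apply/orP; left; apply/eqP; field.
by rewrite !gt_eqF.
Qed.

Lemma likely_frequency (delta : R) : 0 < delta ->
  likely P (fun n w => `|n%:R^-1 * S n w - p| < delta).
Proof.
move=> delta0 rho rho0.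
exists (fun n => [set w | (delta <= `|n%:R^-1 * S n w - p|)%R]); split => [n| |n w].
- exact: measurable_frequency_deviation.
- have rd : 0 < rho * delta ^+ 2 by rewrite mulr_gt0// exprn_gt0.
  (* Beyond this rank, [n] exceeds the inverse of [rho * delta ^+ 2], so the Chebyshev bound is at
     most [rho]. *)
  exists (Num.truncn (rho * delta ^+ 2)^-1).+1 => // n /= nN.
  have n0 : (0 < n)%N by apply: leq_trans nN.
  apply: le_trans (frequency_probability_le n0 delta0) _.
  rewrite lee_fin ler_pdivrMr ?exprn_gt0// -[leRHS]invrK.
  rewrite lef_pV2 ?posrE ?invr_gt0// ?ltr0n//.
  by apply: le_trans (ltW (truncnS_gt _)) _; rewrite ler_nat.
- by rewrite /= leNgt => /negP; rewrite negbK.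
Qed.

End law_of_large_numbers.

(** * The empirical criterion near the true parameter *)

Section near_true_parameter.
Context d (T : measurableType d) (R : realType) (P : probability T R).
Context (J : nat) (J_gt0 : (0 < J)%N) (phi : R -> R -> R).
Context (eps x : nat -> 'I_J -> T -> R) (thetas : 'rV[R]_J).
Context (G : R -> R) (K : R).
Hypothesis meps : forall i j, measurable_fun setT (eps i j).
Hypothesis eps_G : forall i j t, P (eps i j @^-1` `]-oo, t]) = (G t)%:E.
Hypothesis eps_indep : forall i k j t, i != k ->
  P (eps i j @^-1` `]-oo, t] `&` eps k j @^-1` `]-oo, t]) = (G t * G t)%:E.
Hypothesis eps_moment : forall i j, (\int[P]_w (eps i j w ^+ 4)%:E = K%:E)%E.
Hypothesis x_eps : {ae P, forall w, forall i j,
  phi (thetas ord0 j) (x i j w) = eps i j w}.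

Lemma likely_ecdf j t (delta : R) : 0 < delta ->
  likely P (fun n w => `|ecdf (fun i : 'I_n => eps i j w) t - G t| < delta).
Proof.
move=> delta0.
pose E i := eps i j @^-1` `]-oo, t].
have mE i : measurable (E i) by rewrite -[X in measurable X]setTI; exact: meps.
apply: likely_sub (likely_frequency mE (fun i => eps_G i j t)
  (fun i k ik => eps_indep j t ik) delta0) => n w /=.
congr (is_true (`|_ * _ - _| < _)); apply: eq_bigr => i _; rewrite indicE.
suff -> : (w \in E i) = (eps i j w <= t) by [].
by apply/idP/idP; rewrite inE /E /= in_itv.
Qed.

Lemma fourth_moment_ge0 : 0 <= K.
Proof.
rewrite -lee_fin -(eps_moment 0%N (Ordinal J_gt0)); apply: integral_ge0 => w _.
by rewrite lee_fin exprn_even_ge0.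
Qed.

(** Markov's inequality for the sum over [j] of the mean fourth powers, which dominates each of them
    and has expectation [J%:R * K] for every [n > 0]; hence one [C] for all [n]. *)
Lemma fourth_moment_likely (rho : R) : 0 < rho -> exists2 C : R, 0 < C &
  exists B : nat -> set T, [/\ forall n, measurable (B n),
    forall n, (0 < n)%N -> (P (B n) <= rho%:E)%E &
    forall n w, ~ B n w -> forall j, n%:R^-1 * \sum_(i < n) eps i j w ^+ 4 <= C].
Proof.
move=> rho0; pose Y n w := n%:R^-1 * \sum_(i < n) \sum_(j < J) eps i j w ^+ 4.
have mX i j : measurable_fun setT (fun w => eps i j w ^+ 4).
  exact: measurable_funX.
have mY n : measurable_fun setT (Y n).
  apply: measurable_funM => //; apply: measurable_sum => i.
  by apply: measurable_sum => j.
have e4 i j w : 0 <= eps i j w ^+ 4 by rewrite exprn_even_ge0.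
have Y0 n w : 0 <= Y n w.
  by rewrite mulr_ge0 ?invr_ge0// sumr_ge0// => i _; rewrite sumr_ge0.
(* The added 1 keeps [C] positive when [K] is zero. *)
pose C := (J%:R * K + 1) / rho.
have KC : 0 < J%:R * K + 1 by rewrite ltr_wpDl// mulr_ge0// fourth_moment_ge0.
have C0 : 0 < C by rewrite divr_gt0.
exists C => //; exists (fun n => [set w | C <= Y n w]); split => [n|n n0|n w].
- exact: measurable_superlevel.
- have nR : 0 < n%:R :> R by rewrite ltr0n.
  have mB : measurable [set w | C <= Y n w] by exact: measurable_superlevel.
  have := lower_bound_le_integral P (mY n) (Y0 n) mB (ltW C0) (fun _ => id).
  have -> : (\int[P]_w (Y n w)%:E = (J%:R * K)%:E)%E.
    under eq_integral do rewrite /Y EFinM -sumEFin.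
    rewrite ge0_integralZl_EFin//; first last.
    - apply: emeasurable_sum => i; apply/measurable_EFinP.
      by apply: measurable_sum => j.
    - by move=> w _; apply: sume_ge0 => i _; rewrite lee_fin sumr_ge0.
    rewrite ge0_integral_sum//; last 2 first.
    - by move=> i; apply/measurable_EFinP; apply: measurable_sum => j.
    - by move=> i w _; rewrite lee_fin sumr_ge0.
    have intJ (i : 'I_n) :
        (\int[P]_w (\sum_(j < J) eps i j w ^+ 4)%:E = (J%:R * K)%:E)%E.
      under eq_integral do rewrite -sumEFin.
      rewrite ge0_integral_sum//; last 2 first.
      - by move=> j; apply/measurable_EFinP; exact: mX.
      - by move=> j w _; rewrite lee_fin.
      rewrite (eq_bigr _ (fun j _ => eps_moment i j)) sumEFin sumr_const card_ord.
      by rewrite mulr_natl.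
    rewrite (eq_bigr _ (fun i _ => intJ i)) sumEFin sumr_const card_ord.
    by rewrite -EFinM -[(J%:R * K) *+ n]mulr_natl mulKf // gt_eqF.
  rewrite -lee_pdivlMl//; move=> /le_trans; apply.
  rewrite -EFinM lee_fin /C invf_div mulrAC ler_pdivrMr// ler_wpM2l ?(ltW rho0)//.
  by rewrite lerDl.
- rewrite /= => /negP; rewrite -ltNge => /ltW YC j; apply: le_trans YC.
  rewrite ler_wpM2l ?invr_ge0//; apply: ler_sum => i _.
  by rewrite (bigD1 j)//= lerDl sumr_ge0.
Qed.

(** The constants are chosen in the order [C], [M], [eta], [delta], so that each of the three terms
    of [empirical_criterion_le] is at most [kappa / 4]. *)
Lemma likely_empirical_criterion_lt (kappa : R) : 0 < kappa ->
  likely P (fun n w =>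
    (empirical_criterion phi n (fun i j => x i j w) thetas < kappa%:E)%E).
Proof.
move=> kappa0 rho rho0; have rho2 : 0 < rho / 2 by rewrite divr_gt0.
have [C C0 [B1 [mB1 PB1 B1C]]] := fourth_moment_likely rho2.
(* As [M >= 1], its square is also at least [24 * C / kappa], which controls the tail term. *)
pose M := 1 + 24 * C / kappa.
have M1 : 1 <= M by rewrite lerDl !mulr_ge0 ?invr_ge0// ltW.
have M0 : 0 < M by rewrite (lt_le_trans _ M1).
(* With [eta = 2 * M / N%:R], the term [12 * M * eta] is at most [kappa / 4] once [N] reaches
   [96 * M ^+ 2 / kappa]. *)
pose N := (Num.truncn (96 * M ^+ 2 / kappa)).+1.
have NR : 0 < N%:R :> R by rewrite ltr0n.
pose eta := 2 * M / N%:R.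
have eta0 : 0 < eta by rewrite divr_gt0// mulr_gt0.
have Neta : N%:R * eta = 2 * M by rewrite /eta mulrC divfK// gt_eqF.
pose delta := kappa / (48 * M ^+ 2).
have delta0 : 0 < delta by rewrite divr_gt0// mulr_gt0// exprn_gt0.
(* Half of [delta], because two empirical distribution functions are compared through [G]. *)
have delta2 : 0 < delta / 2 by rewrite divr_gt0.
have lik := likely_forall (fun ij : 'I_N * 'I_J =>
  likely_ecdf ij.2 (- M + ij.1%:R * eta) delta2).
have {lik} lik := likelyI (likelyI lik (likely_ae x_eps))
  (likely_near P (nbhs_infty_gt 0)).
have [B2 [mB2 PB2 B2Q]] := lik _ rho2.
exists (fun n => B1 n `|` B2 n); split=> [n| |n w].
- exact: measurableU.
- near=> n; apply: le_trans (measureU2 _ (mB1 n) (mB2 n)) _.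
  rewrite [in leRHS](splitr rho) EFinD; apply: leeD; last by near: n.
  by apply: PB1; near: n; exact: nbhs_infty_gt.
rewrite setCU => -[/B1C mean4 /B2Q[[dev xw] /= n0]].
have yE j : (fun i : 'I_n => phi (thetas ord0 j) (x i j w)) =
    (fun i : 'I_n => eps i j w) by apply/funext => i; exact: xw.
apply: (@le_lt_trans _ _
    (6 * M ^- 2 * C + 12 * M * eta + 12 * M ^+ 2 * delta)%:E).
  apply: (empirical_criterion_le J_gt0 n0 M0 eta0 Neta) => [j|i j k].
    by under eq_bigr do rewrite xw; exact: mean4.
  rewrite !yE.
  have dj := dev (i, j); have dk := dev (i, k); rewrite /= in dj dk.
  rewrite (splitr delta) -(subrKA (G (- M + i%:R * eta))).
  by apply: le_trans (ler_normD _ _) _; rewrite lerD// ltW// distrC.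
rewrite lte_fin.
have M2 : 0 < M ^+ 2 by rewrite exprn_gt0.
have b1 : 6 * M ^- 2 * C <= kappa / 4.
  rewrite mulrAC ler_pdivrMr//.
  have : 24 * C / kappa <= M ^+ 2.
    by apply: (@le_trans _ _ M); [rewrite /M lerDr|rewrite expr2 ler_peMr// ltW].
  rewrite ler_pdivrMr//; lra.
have b2 : 12 * M * eta <= kappa / 4.
  rewrite /eta mulrA ler_pdivrMr//.
  have : 96 * M ^+ 2 / kappa <= N%:R by rewrite ltW// truncnS_gt.
  rewrite ler_pdivrMr//; nra.
have b3 : 12 * M ^+ 2 * delta = kappa / 4 by rewrite /delta; field; rewrite gt_eqF.
lra.
Unshelve. all: by end_near. Qed.

End near_true_parameter.

(** * The empirical criterion away from the true parameter *)

Section compactness.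
Context d (T : measurableType d) (R : realType) (P : probability T R).

(** Sets with such a lower bound are stable under subsets and finite unions, by taking the minimum
    of the constants and intersecting the events; compactness then makes the local bounds global. *)
Lemma compact_likely_lower_bound (V : topologicalType) (C : set V)
    (f : nat -> T -> V -> \bar R) : compact C ->
  (forall v, C v -> exists2 A, nbhs v A & exists2 kappa : R, 0 < kappa &
    likely P (fun n w => forall v', A v' -> C v' -> (kappa%:E <= f n w v')%E)) ->
  exists2 kappa : R, 0 < kappa &
    likely P (fun n w => forall v, C v -> (kappa%:E <= f n w v)%E).
Proof.
move=> Cco locC; pose bounded (A : set V) := exists2 kappa : R, 0 < kappa &
  likely P (fun n w => forall v', A v' -> C v' -> (kappa%:E <= f n w v')%E).
have bounded0 : bounded set0.
  exists 1 => //; apply: likely_sub (likely_near P (nbhs_infty_gt 0)).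
  by move=> n w _ v [].
have boundedU A B : bounded A -> bounded B -> bounded (A `|` B).
  move=> [ka ka0 la] [kb kb0 lb]; exists (Num.min ka kb); first by rewrite lt_min ka0.
  apply: likely_sub (likelyI la lb) => n w [fa fb] v [/fa|/fb] H /H;
    by apply: le_trans; rewrite lee_fin ge_min lexx ?orbT.
have boundedS A B : A `<=` B -> bounded B -> bounded A.
  move=> AB [k k0 l]; exists k => //; apply: likely_sub l => n w H v Av.
  by apply: H; exact: AB.
(* If [C] were not bounded, the sets whose complement in [C] is bounded would
   form a proper filter without cluster point in [C]. *)
have [[k k0 l]|nbC] := pselect (bounded C).
  by exists k => //; apply: likely_sub l => n w H v Cv; exact: H.
pose F : set_system V := fun A => bounded (C `\` A).
have FF : Filter F.
  split; first by rewrite /F setDT.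
  - by move=> A B FA FB; rewrite /F setDIr; exact: boundedU.
  - by move=> A B AB; apply: boundedS; exact: setDS.
have PF : ProperFilter F.
  by apply: Build_ProperFilter_ex => A FA; apply: contrapT => nA; apply: nbC;
    apply: boundedS FA => v Cv; split=> // Av; apply: nA; exists v.
have FC : F C by rewrite /F setDv.
have [v [Cv clv]] := Cco F PF FC.
have [A vA bA] := locC v Cv.
have FnA : F (~` A) by apply: boundedS bA => u [_]; rewrite /= notK.
by have [u [nAu Au]] := clv _ _ FnA vA.
Qed.

End compactness.

Section away_from_true_parameter.
Context d (T : measurableType d) (R : realType) (P : probability T R).
Context (J : nat) (J_gt0 : (0 < J)%N) (phi : R -> R -> R).
Context (Lambda I : set R).
Context (eps x : nat -> 'I_J -> T -> R) (thetas : 'rV[R]_J) (G : R -> R).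
Hypothesis thetas_in : parameter_space Lambda thetas.
Hypothesis phi_incr : forall l, Lambda l ->
  {in I &, {homo phi l : x y / x < y}}.
Hypothesis phi_cont : forall l z, Lambda l -> I z -> forall e : R, 0 < e ->
  exists2 r : R, 0 < r & forall l', Lambda l' -> `|l - l'| < r ->
    `|phi l z - phi l' z| < e.
Hypothesis ecdf_G : forall j t (delta : R), 0 < delta ->
  likely P (fun n w => `|ecdf (fun i : 'I_n => eps i j w) t - G t| < delta).
Hypothesis x_eps : {ae P, forall w, forall i j, I (x i j w) /\
  phi (thetas ord0 j) (x i j w) = eps i j w}.

Lemma le_ecdf n (y z : 'I_n -> R) (s t : R) :
  (forall i, y i <= s -> z i <= t) -> ecdf y s <= ecdf z t.
Proof.
move=> yz; rewrite /ecdf ler_wpM2l ?invr_ge0//; apply: ler_sum => i _.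
by rewrite ler_nat; case: (leP (y i) s) => // /yz ->.
Qed.

(** For every [theta'], the inequalities between [phi theta'_j x_ij] and [phi theta'_j z1] are those
    between [eps i j] and [phi thetas_j z1]. The frequencies involved do not depend on [theta'], so
    a single event serves a whole neighbourhood. *)
Lemma likely_empirical_criterion_ge (theta : 'rV[R]_J) j k z1 z2 :
  parameter_space Lambda theta -> I z1 -> I z2 ->
  phi (theta ord0 j) z1 < phi (theta ord0 k) z2 ->
  G (phi (thetas ord0 k) z2) < G (phi (thetas ord0 j) z1) ->
  exists2 A, nbhs theta A & exists2 kappa : R, 0 < kappa &
    likely P (fun n w => forall theta', A theta' ->
      parameter_space Lambda theta' ->
      (kappa%:E <= empirical_criterion phi n (fun i j => x i j w) theta')%E).
Proof.
move=> thetaL Iz1 Iz2 phi12 G21.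
(* A quarter of the gap: [s] and [s + 2 * h] stay at distance [h] from the two values at [theta], so
   moving each value by less than [h] keeps them on the right sides. *)
pose h := (phi (theta ord0 k) z2 - phi (theta ord0 j) z1) / 4.
have h0 : 0 < h by rewrite divr_gt0// subr_gt0.
pose s := phi (theta ord0 j) z1 + h.
pose Delta := G (phi (thetas ord0 j) z1) - G (phi (thetas ord0 k) z2).
have Delta0 : 0 < Delta by rewrite subr_gt0.
have [r1 r10 phir1] := phi_cont (thetaL j) Iz1 h0.
have [r2 r20 phir2] := phi_cont (thetaL k) Iz2 h0.
(* An error of [Delta / 4] on each frequency leaves a difference of at least [Delta / 2]. *)
have Delta4 : 0 < Delta / 4 by rewrite divr_gt0.
have JR : 0 < 2 * J%:R :> R by rewrite mulr_gt0// ltr0n.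
exists (ball theta (Num.min r1 r2)); first by apply: nbhsx_ballx; rewrite lt_min r10.
exists (h ^+ 2 * (Delta / 2) / (2 * J%:R)).
  by rewrite divr_gt0// mulr_gt0// ?exprn_gt0// divr_gt0.
have lik := likelyI (likelyI (ecdf_G j (phi (thetas ord0 j) z1) Delta4)
  (ecdf_G k (phi (thetas ord0 k) z2) Delta4))
  (likelyI (likely_ae x_eps) (likely_near P (nbhs_infty_gt 0))).
apply: likely_sub lik => n w [[/= devj devk] [xw n0]] theta' thetab thetaL'.
have close i : `|theta ord0 i - theta' ord0 i| < Num.min r1 r2.
  by have [_ /(_ ord0 i)] := thetab.
have t1 : `|phi (theta ord0 j) z1 - phi (theta' ord0 j) z1| < h.
  by apply: phir1 => //; apply: lt_le_trans (close j) _; rewrite ge_min lexx.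
have t2 : `|phi (theta ord0 k) z2 - phi (theta' ord0 k) z2| < h.
  by apply: phir2 => //; apply: lt_le_trans (close k) _; rewrite ge_min lexx orbT.
have hE : phi (theta ord0 k) z2 = phi (theta ord0 j) z1 + 4 * h.
  by rewrite /h; field.
apply: (@empirical_criterion_ge _ _ J_gt0 phi n (fun i j => x i j w) theta'
  j k s h (Delta / 2)) => //.
  by rewrite ltW// divr_gt0.
have Fj : ecdf (fun i : 'I_n => eps i j w) (phi (thetas ord0 j) z1) <=
    ecdf (fun i : 'I_n => phi (theta' ord0 j) (x i j w)) s.
  apply: le_ecdf => i; have [Ix <-] := xw i j.
  rewrite (increasing_leE (phi_incr (thetas_in j)))// => xz.
  apply: (@le_trans _ _ (phi (theta' ord0 j) z1)).
    by rewrite (increasing_leE (phi_incr (thetaL' j))).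
  by move: t1; rewrite ltr_norml /s; lra.
have Fk : ecdf (fun i : 'I_n => phi (theta' ord0 k) (x i k w)) (s + 2 * h) <=
    ecdf (fun i : 'I_n => eps i k w) (phi (thetas ord0 k) z2).
  apply: le_ecdf => i; have [Ix <-] := xw i k => xs.
  rewrite (increasing_leE (phi_incr (thetas_in k)))//.
  rewrite -(increasing_leE (phi_incr (thetaL' k)))//; apply: (le_trans xs).
  by move: t2; rewrite ltr_norml hE /s; lra.
move: devj devk; rewrite !ltr_norml => /andP[dj _] /andP[_ dk].
rewrite -/Delta; apply: (@le_trans _ _
  (ecdf (fun i : 'I_n => eps i j w) (phi (thetas ord0 j) z1) -
   ecdf (fun i : 'I_n => eps i k w) (phi (thetas ord0 k) z2))).
  by rewrite /Delta in dj dk *; lra.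
exact: lerB.
Qed.

End away_from_true_parameter.

(** * Fourth moments from moments of higher order *)

Section moments.
Context d (T : measurableType d) (R : realType) (P : probability T R).

(* The supremum over [Lambda] in the moment hypothesis is not known to be
   measurable. *)
Lemma le_integral_nonmeasurable (f g : T -> \bar R) :
  (forall w, 0 <= f w)%E -> (forall w, f w <= g w)%E ->
  (\int[P]_w f w <= \int[P]_w g w)%E.
Proof.
move=> f0 fg; rewrite !ge0_integralTE//; last first.
  by move=> w; exact: le_trans (f0 w) (fg w).
by apply: le_ereal_sup => _ [h hf <-]; exists h => // w; exact: le_trans (fg w).
Qed.

(** A fourth power is at most 1 plus a power of order [r > 4], and the latter is dominated almost
    everywhere by [h] on [D]. *)
Lemma fourth_moment_finite (D : set T) (f : T -> R) (h : T -> \bar R) (r : R) :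
  measurable_fun setT f -> 4 < r ->
  {ae P, forall w, D w /\ ((`|f w| `^ r)%:E <= h w)%E} ->
  (forall w, 0 <= h w)%E ->
  (\int[P]_(w in D) h w < +oo)%E ->
  (\int[P]_w (f w ^+ 4)%:E < +oo)%E.
Proof.
move=> mf r4 [N [mN PN0 Nsub]] h0 hoo.
have mpow : measurable_fun setT (fun w => `|f w| `^ r).
  apply: (@measurableT_comp _ _ _ _ _ _ (fun z : R => z `^ r)).
    exact: measurable_powR.
  exact: measurableT_comp.
have powoo : (\int[P]_w (`|f w| `^ r)%:E < +oo)%E.
  (* The null set is removed on the side of the measurable integrand, which leaves a pointwise
     comparison with [h]. *)
  rewrite (ge0_negligible_integral mN measurableT _ _ PN0); last 2 first.
  - exact/measurable_EFinP.
  - by move=> w _; rewrite lee_fin powR_ge0.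
  apply: le_lt_trans hoo; rewrite integral_mkcond [leRHS]integral_mkcond.
  apply: le_integral_nonmeasurable => w.
    by rewrite patchE; case: ifP => _ //; rewrite lee_fin powR_ge0.
  rewrite !patchE; have [|_] := boolP (w \in [set: T] `\` N); last by case: ifP.
  rewrite inE => -[_ nN].
  have [Dw le_h] : D w /\ ((`|f w| `^ r)%:E <= h w)%E.
    by apply: contrapT => H; apply: nN; exact: Nsub.
  by rewrite mem_set.
apply: (@le_lt_trans _ _ (\int[P]_w (1 + (`|f w| `^ r)%:E))%E).
  apply: ge0_le_integral => //.
  - by move=> w _; rewrite lee_fin exprn_even_ge0.
  - by apply/measurable_EFinP; exact: measurable_funX.
  - by apply: emeasurable_funD => //; exact/measurable_EFinP.
  move=> w _; rewrite -EFinD lee_fin.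
  have -> : f w ^+ 4 = `|f w| ^+ 4 by rewrite -normrX ger0_norm// exprn_even_ge0.
  have [f1|f1] := leP `|f w| 1.
    by rewrite (@le_trans _ _ 1) ?exprn_ile1// lerDl powR_ge0.
  rewrite -powR_mulrn// (@le_trans _ _ (`|f w| `^ r))//; last by rewrite lerDr.
  by rewrite ler_powR// ltW.
rewrite ge0_integralD//; last exact/measurable_EFinP.
by rewrite integral_cst_probability lte_add_pinfty// ltry.
Qed.

End moments.

(** * Consistency *)

Lemma ae_le_probability d (T : measurableType d) (R : realType)
    (P : probability T R) (A B : set T) :
  measurable A -> measurable B -> {ae P, forall w, A w -> B w} ->
  (P A <= P B)%E.
Proof.
move=> mA mB [N [mN PN0 sub]]; rewrite -[leRHS]adde0 -PN0.
apply: le_trans (measureU2 _ mB mN); apply: le_measure; rewrite ?inE//.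
  exact: measurableU.
move=> w Aw; have [Bw|nBw] := pselect (B w); [by left|right].
by apply: sub => /(_ Aw).
Qed.

Lemma ae_forall_ord d (T : measurableType d) (R : realType)
    (P : probability T R) (J : nat) (Q : 'I_J -> T -> Prop) :
  (forall j, {ae P, forall w, Q j w}) -> {ae P, forall w, forall j, Q j w}.
Proof.
move=> Qae.
have : {ae P, forall w, forall m : nat, forall j : 'I_J, j = m :> nat -> Q j w}.
  apply: ae_foralln => m; have [mJ|Jm] := ltnP m J.
    apply: filterS (Qae (Ordinal mJ)) => w Qw j jm.
    by rewrite (_ : j = Ordinal mJ) //; exact: val_inj.
  by apply: aeW => w j jm; move: Jm; rewrite -jm leqNgt ltn_ord.
by apply: filterS => w H j; exact: H.
Qed.

Lemma within_product_continuous (R : realType) (A B : set R) (f : R -> R -> R) :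
  {within A `*` B, continuous (fun lx : R * R => f lx.1 lx.2)} ->
  forall l z, A l -> B z -> forall e : R, 0 < e ->
  exists2 r : R, 0 < r & forall l', A l' -> `|l - l'| < r ->
    `|f l z - f l' z| < e.
Proof.
move=> /subspace_continuousP fc l z Al Bz e e0.
have /cvgrPdist_lt/(_ e e0) := fc (l, z) (conj Al Bz).
move=> [[U V] /= [/nbhs_ballP[r r0 rU] Vz] UV]; exists r => // l' Al' ll'.
by apply: (UV (l', z)); split=> //=; [exact: rU|exact: nbhs_singleton].
Qed.

(** The norm on rows is the maximum of the coordinates, so the event is a finite union over
    coordinates. *)
Lemma measurable_row_dist d (T : measurableType d) (R : realType) (J : nat)
    (Y : 'I_J -> T -> R) (y : 'rV[R]_J) (e : R) : 0 < e ->
  (forall j, measurable_fun setT (Y j)) ->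
  measurable [set w | e <= `|\row_j Y j w - y|].
Proof.
move=> e0 mY.
rewrite (_ : [set w | _] = \bigcup_(j in [set: 'I_J]) [set w | e <= `|Y j w - y ord0 j|]).
  apply: fin_bigcup_measurable => [|j _]; first exact: finite_finset.
  apply: measurable_superlevel; apply: measurableT_comp => //.
  exact: measurable_funB.
have ballE w : ball (\row_j Y j w) e y <-> `|\row_j Y j w - y| < e.
  by rewrite mx_norm_ball.
apply/seteqP; split=> w /=.
  move=> ew; apply: contrapT => nj; move: ew; apply/negP; rewrite -ltNge.
  apply/ballE; split=> // i j; rewrite (ord1 i) mxE -ball_normE /=.
  by rewrite ltNge; apply/negP => ej; apply: nj; exists j.
move=> [j _ /= ej]; rewrite leNgt; apply/negP => /ballE[_ /(_ ord0 j)].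
by rewrite mxE -ball_normE /= ltNge ej.
Qed.

Lemma cvg_in_probability_likely d (T : measurableType d) (R : realType)
    (P : probability T R) (V : normedModType R) (Y : nat -> T -> V) (y : V) :
  (forall e : R, 0 < e -> (forall n, measurable [set w | e <= `|Y n w - y|]) /\
    likely P (fun n w => `|Y n w - y| < e)) ->
  cvg_in_probability P Y y.
Proof.
move=> H e e0; have [mE lE] := H e e0.
apply/fine_cvgP; split.
  by apply: nearW => n; exact: fin_num_measure.
apply/cvgrPdist_le => rho rho0.
have := likely_probability_le lE mE _ rho0.
have nE n w : [set w | e <= `|Y n w - y|] w -> ~ `|Y n w - y| < e.
  by rewrite /= leNgt => /negP.
move=> /(_ nE); apply: filterS => n.
rewrite sub0r normrN ger0_norm ?fine_ge0// -lee_fin fineK//.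
exact: fin_num_measure.
Qed.

Theorem proposition4p1 (R : realType)
    (disp : measure_display) (Omega : measurableType disp)
    (P : probability Omega R)
    (J : nat) (J_gt0 : (0 < J)%N)
    (Lambda : set R) (a b c d : \bar R) (cj dj : 'I_J -> \bar R)
    (phi : R -> R -> R)
    (mu : probability (measurableTypeR R) R)
    (eps X : nat -> 'I_J -> {RV P >-> R})
    (thetas : 'rV[R]_J)
    (thetahat : nat -> 'I_J -> {RV P >-> R})
    (G := distribution_function mu)
    (g : R -> R := G^`())
    (dphi : R -> R -> R := fun l => (phi l)^`())
    (muj := fun j : 'I_J => distribution P (X 0%N j))
    (U := criterion phi (ooI c d) muj)
    (Un := fun (n : nat) (w : Omega) =>
       empirical_criterion phi n (fun i j => X i j w))
    (* deformation model *)
    (thetas_in : parameter_space Lambda thetas)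
    (mu_supp : mu (ooI a b) = 1%E)
    (eps_law : forall i j (A : set R), measurable A ->
       distribution P (eps i j) A = mu A)
    (eps_indep : @mutually_independent _ Omega R P (nat * 'I_J)%type
       (fun ij => eps ij.1 ij.2))
    (X_model : forall i j, {ae P, forall w,
       X i j w =
       'pinv_(fun=> 0) (ooI c d) (phi (thetas ord0 j)) (eps i j w)})
    (X_supp : forall j, muj j (ooI (cj j) (dj j)) = 1%E)
    (* (1) *)
    (ab : (a < b)%E)
    (cd_j : forall j, [/\ c <= cj j, cj j < dj j & dj j <= d]%E)
    (phi_bij : forall l, Lambda l -> set_bij (ooI c d) (ooI a b) (phi l))
    (phi_incr : forall l, Lambda l ->
       {in ooI c d &, {homo phi l : x y / x < y}})
    (* (2) *)
    (G_C2 : [/\ {in ooI a b, forall x : R, derivable G x 1},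
                {in ooI a b, forall x : R, derivable g x 1} &
                {in ooI a b, continuous g^`()}])
    (g_gt0 : {in ooI a b, forall x, 0 < g x})
    (G_sup : (ereal_sup [set ((G x * (1 - G x) * derive1 g x / g x ^+ 2)%R)%:E
                        | x in ooI a b] < +oo)%E)
    (* (3) *)
    (phi_cont : {within Lambda `*` ooI c d,
       continuous (fun lx : R * R => phi lx.1 lx.2)})
    (phi_C1 : forall l, Lambda l ->
       {in ooI c d, forall x : R, derivable (phi l) x 1} /\
       {in ooI c d, continuous (dphi l)})
    (Lambda_compact : compact Lambda)
    (* (4) *)
    (dphi_bounded : forall j, exists M : R, forall l x, Lambda l ->
       (ooI c d `&` ccI (cj j) (dj j)) x -> `|dphi l x| <= M)
    (dphi_cont : forall j x, (ooI c d `&` ccI (cj j) (dj j)) x ->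
       {within Lambda, continuous (fun l => dphi l x)})
    (dphi_unif : forall j (x : R) (xn : nat -> R -> R),
       (ooI c d `&` ccI (cj j) (dj j)) x ->
       (forall n l, Lambda l ->
          (ooI c d `&` ccI (cj j) (dj j)) (xn n l)) ->
       ereal_sup [set `|xn n l - x|%:E | l in Lambda] @[n --> \oo]
         --> (0 : \bar R)%E ->
       ereal_sup [set `|dphi l (xn n l) - dphi l x|%:E
                 | l in Lambda] @[n --> \oo] --> (0 : \bar R)%E)
    (* (5) *)
    (X_moment : forall j, exists2 r : R, 4 < r &
       ('E_P[(fun w => `|X 0%N j w| `^ r)%R] < +oo)%E)
    (* (6) *)
    (phi_moment : forall j, exists2 r : R, 4 < r &
       (\int[P]_(w in X 0%N j @^-1` ooI c d)
          ereal_sup [set ((`|phi l (X 0%N j w)| `^ r)%R)%:E | l in Lambda]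
        < +oo)%E)
    (* (7) *)
    (U_min : argmin (parameter_space Lambda) U = [set thetas])
    (thetas_int : interior (parameter_space Lambda) thetas)
    (* the estimator *)
    (thetahat_min : forall n, (0 < n)%N -> {ae P, forall w,
       argmin (parameter_space Lambda) (Un n w)
         (\row_j thetahat n j w)}) :
  cvg_in_probability P (fun n w => \row_j thetahat n j w) thetas.
Proof.
have j0 : 'I_J by exact: Ordinal J_gt0.
have tin j : Lambda (thetas ord0 j) by exact: thetas_in.
have mRV (Y : {RV P >-> R}) : measurable_fun setT (Y : Omega -> R).
  exact: measurable_funPT.
have eps_muE i j A : measurable A -> P (eps i j @^-1` A) = mu A.
  by move=> mA; rewrite -(eps_law i j)//.
(* Almost surely [eps i j] lies in the range of [phi thetas_j], where the partial inverse of the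
   model is a true one. *)
have X_eps : {ae P, forall w, forall i j, ooI c d (X i j w) /\
    phi (thetas ord0 j) (X i j w) = eps i j w}.
  apply: ae_foralln => i; apply: ae_forall_ord => j.
  have eps_ab : {ae P, forall w, ooI a b (eps i j w)}.
    exists (~` (eps i j @^-1` ooI a b)); split.
    - apply: measurableC; rewrite -[X in measurable X]setTI; apply: mRV => //.
      exact: measurable_ooI.
    - rewrite probability_setC ?eps_muE ?mu_supp ?subee//.
      + exact: measurable_ooI.
      + rewrite -[X in measurable X]setTI; apply: mRV => //.
        exact: measurable_ooI.
    - by [].
  apply: filterS2 eps_ab (X_model i j) => w epsab ->.
  have [_ _ fS] := phi_bij _ (tin j); split.
    by apply: (surjpinv_image_sub fS); exists (eps i j w).
  by rewrite (surjpK _ fS) ?inE.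
have mray (Y : {RV P >-> R}) t : measurable (Y @^-1` `]-oo, t]).
  by rewrite -[X in measurable X]setTI; apply: mRV.
have GE t : (G t)%:E = mu `]-oo, t] by exact: distribution_functionE.
have eps_G i j t : P (eps i j @^-1` `]-oo, t]) = (G t)%:E.
  by rewrite GE eps_muE.
have eps_pair i k j t : i != k ->
    P (eps i j @^-1` `]-oo, t] `&` eps k j @^-1` `]-oo, t]) = (G t * G t)%:E.
  move=> ik; have ikj : uniq [:: (i, j); (k, j)].
    by rewrite /= andbT inE; apply: contra ik => /eqP[->].
  have := eps_indep _ (fun=> `]-oo, t]%classic) ikj (fun=> measurable_itv _).
  rewrite 2!big_cons big_nil mule1 /= !eps_G EFinM => <-; congr (P _).
  apply/seteqP; split=> w.
    by move=> [wi wk] ij /=; rewrite !inE => /orP[] /eqP->.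
  by move=> H; split; [apply: (H (i, j))|apply: (H (k, j))]; rewrite /= !inE eqxx ?orbT.
have muX4 : measurable_fun setT (fun z : measurableTypeR R => (z ^+ 4)%:E : \bar R).
  by apply/measurable_EFinP; exact: measurable_funX.
have z4 (z : R) : (0 <= (z ^+ 4)%:E)%E by rewrite lee_fin exprn_even_ge0.
have eps4 i j : (\int[P]_w (eps i j w ^+ 4)%:E = \int[mu]_z (z ^+ 4)%:E)%E.
  have [q qE] := @pushforward_probability _ _ _ (measurableTypeR R) _ P _
    (mRV (eps i j)).
  transitivity (\int[q]_z (z ^+ 4)%:E)%E.
    by rewrite qE ge0_integral_pushforward//; exact: mRV.
  apply: eq_measure_integral => A mA _.
  exact: etrans (congr1 (@^~ A) qE) (eps_law i j A mA).
(* The errors inherit the moments assumed for the transformed observations: the supremum over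
   [Lambda] dominates its value at the true parameter, where the transformed observation is the
   error. *)
have [K KE] : exists K : R, (\int[mu]_z (z ^+ 4)%:E)%E = K%:E.
  exists (fine (\int[mu]_z (z ^+ 4)%:E)); rewrite fineK// ge0_fin_numE ?integral_ge0//.
  rewrite -(eps4 0%N j0); have [r r4 phir] := phi_moment j0.
  apply: (fourth_moment_finite (mRV (eps 0%N j0)) r4 _ _ phir).
  - apply: filterS X_eps => w /(_ 0%N j0)[Xw eX]; split=> //.
    by apply: ereal_sup_ubound; exists (thetas ord0 j0); rewrite ?eX.
  - move=> w; apply: (@le_trans _ _
      (`|phi (thetas ord0 j0) (X 0%N j0 w)| `^ r)%:E); first by rewrite lee_fin powR_ge0.
    by apply: ereal_sup_ubound; exists (thetas ord0 j0).
(* This is the identity of [F_j] with [G] composed with [phi thetas_j], from the equivalence of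
   [X <= z] and [eps <= phi thetas_j z]. *)
have XG j z : ooI c d z -> P (X 0%N j @^-1` `]-oo, z]) = (G (phi (thetas ord0 j) z))%:E.
  move=> Iz; rewrite -(eps_G 0%N j); have leE := increasing_leE (phi_incr _ (tin j)).
  by apply/le_anti/andP; split; apply: ae_le_probability => //;
    apply: filterS X_eps => w /(_ 0%N j)[Xw eX]; rewrite /= !in_itv/= -eX leE.
have /choice[p pE] j : exists q : probability (measurableTypeR R) R,
    q = pushforward P (X 0%N j) :> (set R -> \bar R).
  apply: (@pushforward_probability _ _ _ (measurableTypeR R)); exact: mRV.
have pF j z : ooI c d z ->
    distribution_function (p j) z = G (phi (thetas ord0 j) z).
  move=> Iz; apply: EFin_inj; rewrite distribution_functionE pE -XG//.
have pI j : p j (ooI c d) = 1%E.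
  apply/le_anti; rewrite probability_le1/=; last exact: measurable_ooI.
  have -> : (1%E = p j (ooI (cj j) (dj j)))%E by rewrite pE -(X_supp j).
  apply: le_measure; rewrite ?inE; [exact: measurable_ooI|exact: measurable_ooI|].
  have [cc _ dd] := cd_j j.
  by move=> z /andP[cz zd]; rewrite /ooI/= (le_lt_trans cc cz) (lt_le_trans zd dd).
have UE : U = criterion phi (ooI c d) (fun j => p j).
  by rewrite /U; congr criterion; apply/funext => j; rewrite pE.
have ecdf_lik := likely_ecdf (fun i j => mRV (eps i j)) eps_G eps_pair.
apply: cvg_in_probability_likely => e e0; split=> [n|].
  by apply: measurable_row_dist => // j; exact: mRV.
(* The parameters to be excluded form a closed part of a compact power. *)
pose C := parameter_space Lambda `&` [set theta | e <= `|theta - thetas|].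
have Cco : compact C.
  apply: compact_closedI; first exact: (@rV_compact _ _ (fun=> Lambda)).
  rewrite (_ : [set theta | _] = ~` ball thetas e).
    by apply: open_closedC; exact: ball_open.
  apply/seteqP; split=> theta /=; rewrite mx_norm_ball /= distrC.
    by rewrite leNgt => /negP.
  by move=> /negP; rewrite -leNgt.
have [kappa kappa0 lik_far] : exists2 kappa : R, 0 < kappa &
    likely P (fun n w => forall theta, C theta -> (kappa%:E <= Un n w theta)%E).
  apply: compact_likely_lower_bound => // theta [thetaL far].
  (* If [U] vanished at [theta], this point would be a minimizer, hence equal to [thetas], contrary
     to its distance [e > 0]. *)
  have [U0|[j [k [z1 [z2 [Iz1 Iz2 phi12 F21]]]]]] :=
    criterion0_or_separated J_gt0 phi_bij phi_incr pI thetaL.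
    have : argmin (parameter_space Lambda) U theta.
      by split=> // theta' _; rewrite UE U0; exact: criterion_ge0.
    rewrite U_min => /= thetaE; move: far => /=.
    by rewrite thetaE subrr normr0 /= leNgt e0.
  have [|A thetaA [kappa kappa0 lik]] := likely_empirical_criterion_ge J_gt0 thetas_in phi_incr
    (within_product_continuous phi_cont) ecdf_lik X_eps thetaL Iz1 Iz2 phi12.
    by rewrite -!pF.
  exists A => //; exists kappa => //; apply: likely_sub lik => n w H theta' At [Lt _].
  exact: H.
have X_eps' : {ae P, forall w, forall i j,
    phi (thetas ord0 j) (X i j w) = eps i j w}.
  by apply: filterS X_eps => w H i j; case: (H i j).
have lik_near := likely_empirical_criterion_lt J_gt0 (fun i j => mRV (eps i j))
  eps_G eps_pair (fun i j => etrans (eps4 i j) KE)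
  X_eps' kappa0.
(* [likely_ae] takes one event for all [n], so the quantifier over the countably many [n] is moved
   inside; the case [n = 0] is vacuous. *)
have argmin_ae : {ae P, forall w, forall n, (0 < n)%N ->
    argmin (parameter_space Lambda) (Un n w) (\row_j thetahat n j w)}.
  apply: ae_foralln => -[|n]; first by apply: aeW.
  by apply: filterS (thetahat_min n.+1 isT) => w.
have lik := likelyI (likelyI lik_far lik_near)
  (likelyI (likely_ae argmin_ae) (likely_near P (nbhs_infty_gt 0))).
apply: likely_sub lik => n w [[far near] [/= hatP n0]].
have [hatL hat_min] := hatP n n0.
(* On these events an estimator at distance at least [e] would have a criterion of at least [kappa],
   while minimality puts it below the value at [thetas], which is less than [kappa]. *)
rewrite ltNge; apply/negP => ehat.
have := far _ (conj hatL ehat); apply/negP; rewrite -ltNge.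
by apply: le_lt_trans near; exact: hat_min.
Qed.
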